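(* Let $A,B,C$ be pairwise disjoint finite subsets of $\mathbb Z$ and let $\varphi$ be a faithful state on $\mathcal A_{ABC}=\mathcal A(A\cup B\cup C)$. Let $\rho_{BC}\in\mathcal A_{BC}$ be the density of $\varphi|_{\mathcal A_{BC}}$ and let $$\mathcal C=\{x\in\mathcal A_{AB}:\ \rho_{BC}^{it}\,x\,\rho_{BC}^{-it}\in\mathcal A_{AB}\ \text{for all } t\in\mathbb R\}.$$ Then $\varphi$ is a Markov triplet if and only if $\varphi$ satisfies equality in strong subadditivity, i.e. $S(\varphi)-S(\varphi_{AB})-S(\varphi_{BC})+S(\varphi_B)=0$, and $\mathcal A_A\subseteq\mathcal C$.
   Context: CAR algebra: the $C^*$-algebra generated by $\{a_i: i\in\mathbb Z\}$ with $a_ia_j+a_ja_i=0$ and $a_ia_j^*+a_j^*a_i=\delta_{ij}1$ for all $i,j$. For $I\subset\mathbb Z$, $\mathcal A(I)$ is the unital $C^*$-subalgebra generated by $\{a_i: i\in I\}$; for finite $I$ it is isomorphic to the full matrix algebra $M_{2^{|I|}}(\mathbb C)$. $\tau$ is the unique tracial state. For disjoint finite $A,B,C$ write $\mathcal A_A=\mathcal A(A)$, $\mathcal A_{AB}=\mathcal A(A\cup B)$, etc., and let $\varphi_{AB},\varphi_{BC},\varphi_B$ be the restrictions of $\varphi$ to $\mathcal A_{AB},\mathcal A_{BC},\mathcal A_B$. The density of a state $\psi$ on $\mathcal A(I)$ ($I$ finite) is the element $\rho_\psi\in\mathcal A(I)$ with $\psi(x)=\tau(\rho_\psi x)$ for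 all $x\in\mathcal A(I)$, and the entropy is $S(\psi)=-\tau(\rho_\psi\log\rho_\psi)$. The inequality $S(\varphi)-S(\varphi_{AB})-S(\varphi_{BC})+S(\varphi_B)\le 0$ always holds. Markov triplet: $\varphi$ is a Markov triplet if there is a completely positive, identity preserving map $E:\mathcal A_{ABC}\to\mathcal A_{AB}$ such that (i) $E(xy)=xE(y)$ for all $x\in\mathcal A_A$, $y\in\mathcal A_{ABC}$; (ii) $\varphi\circ E=\varphi$; (iii) $E(\mathcal A_{BC})\subseteq\mathcal A_B$. *)

(* Defs.v *)
From HB Require Import structures.
From mathcomp Require Import all_boot all_order all_algebra.
From mathcomp Require Import complex.
From mathcomp Require Import all_classical all_reals all_analysis.

Set Implicit Arguments.
Unset Strict Implicit.
Unset Printing Implicit Defensive.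

Import Order.TTheory GRing.Theory Num.Theory.
Import numFieldNormedType.Exports.

Local Open Scope classical_set_scope.
Local Open Scope ring_scope.
Local Open Scope complex_scope.

(* Unital complex C*-algebras. The norm is a field of its own, with values in
   R, and is not the one of normedModType: the hierarchy does not allow a
   normed space to be joined with a ring outside numDomainType. *)
HB.mixin Record Algebra_isCStarAlgebra (R : realType) A
    of GRing.Algebra R[i] A := {
  star : A -> A ;
  starK : involutive star ;
  star_semilinear : forall (c : R[i]) (x y : A),
    star (c *: x + y) = c^* *: star x + star y ;
  starM : forall x y : A, star (x * y) = star y * star x ;
  cnorm : A -> R ;
  cnorm_eq0 : forall x : A, cnorm x = 0 -> x = 0 ;
  cnormD_le : forall x y : A, cnorm (x + y) <= cnorm x + cnorm y ;
  cnormZ : forall (c : R[i]) (x : A),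
    cnorm (c *: x) = ComplexField.Normc.normc c * cnorm x ;
  cnormM_le : forall x y : A, cnorm (x * y) <= cnorm x * cnorm y ;
  cnorm_starM : forall x : A, cnorm (star x * x) = cnorm x ^+ 2 ;
  cnorm_complete : forall u : nat -> A,
    (forall e : R, 0 < e -> exists N : nat, forall m n : nat,
       (N <= m)%N -> (N <= n)%N -> cnorm (u m - u n) < e) ->
    exists l : A, (fun n => cnorm (u n - l)) @ \oo --> (0 : R)
}.

#[short(type="cstarAlgType")]
HB.structure Definition CStarAlgebra (R : realType) :=
  {A of GRing.Algebra R[i] A & Algebra_isCStarAlgebra R A}.

Section CStar.
Context (R : realType) (T : cstarAlgType R).
Implicit Types (S : set T) (phi tau : T -> R[i]) (x y : T).

Definition norm_closed S : Prop :=
  forall (u : nat -> T) (l : T), (forall n, S (u n)) ->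
    (fun n => cnorm (u n - l)) @ \oo --> (0 : R) -> S l.

Definition cstar_subalgebra S : Prop :=
  [/\ S 1,
      forall (c : R[i]) x y, S x -> S y -> S (c *: x + y),
      forall x y, S x -> S y -> S (x * y),
      forall x, S x -> S (star x)
    & norm_closed S].

Definition cstar_generated (G : set T) : set T := smallest cstar_subalgebra G.

(* Maps defined on a subalgebra S are total functions whose values outside S
   are irrelevant; restricting phi to S' means reading it relatively to S'. *)
Definition linear_on (V : lmodType R[i]) S (f : T -> V) : Prop :=
  forall (c : R[i]) x y, S x -> S y -> f (c *: x + y) = c *: f x + f y.

Definition state_on S phi : Prop :=
  [/\ linear_on (V := R[i]^o) S phi,
      forall x, S x -> 0 <= phi (star x * x)
    & phi 1 = 1].

Definition faithful_state_on S phi : Prop :=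
  state_on S phi /\ forall x, S x -> phi (star x * x) = 0 -> x = 0.

Definition tracial_state tau : Prop :=
  state_on setT tau /\ forall x y, tau (x * y) = tau (y * x).

(* Positivity in the matrix C*-algebra M_n(S): X = Y^* Y with Y in M_n(S). *)
Definition mx_positive n S (X : 'M[T]_n) : Prop :=
  exists Y : 'M[T]_n,
    (forall i j, S (Y i j)) /\ X = (map_mx (@star R T) Y)^T *m Y.

Definition completely_positive S (S' : set T) (E : T -> T) : Prop :=
  [/\ linear_on S E,
      forall x, S x -> S' (E x)
    & forall n (X : 'M[T]_n), mx_positive S X -> mx_positive S' (map_mx E X)].

(* y = f(x) by functional calculus, for x self-adjoint of finite spectrum:
   x = \sum_k l_k p_k and y = \sum_k f(l_k) p_k for mutually orthogonal
   projections p_k of sum 1. *)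
Definition is_fcalc (f : R -> R[i]) x y : Prop :=
  exists (n : nat) (l : 'I_n -> R) (p : 'I_n -> T),
    [/\ forall k, star (p k) = p k,
        forall j k, p j * p k = if j == k then p k else 0,
        \sum_k p k = 1,
        x = \sum_k (l k)%:C *: p k
      & y = \sum_k f (l k) *: p k].

(* Such a y is unique; every self-adjoint element of a finite-dimensional
   C*-algebra has one. *)
Definition fcalc (f : R -> R[i]) x : T := xget 0 [set y | is_fcalc f x y].

Definition log x : T := fcalc (fun s => (ln s)%:C) x.

(* x^{it}, via s^{it} = cos (t ln s) + i sin (t ln s) for s > 0. *)
Definition ipow x (t : R) : T :=
  fcalc (fun s => cos (t * ln s) +i* sin (t * ln s)) x.

Definition is_density tau S phi (rho : T) : Prop :=
  S rho /\ forall x, S x -> phi x = tau (rho * x).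

Definition density tau S phi : T := xget 0 [set rho | is_density tau S phi rho].

Definition entropy tau S phi : R[i] :=
  - tau (density tau S phi * log (density tau S phi)).

End CStar.

Section CAR.
Context (R : realType) (T : cstarAlgType R).
Implicit Types (a : int -> T) (A B C I : set int) (phi tau : T -> R[i]).

Definition is_CAR a : Prop :=
  [/\ forall i j, a i * a j + a j * a i = 0,
      forall i j, a i * star (a j) + star (a j) * a i = (i == j)%:R
    & cstar_generated (range a) = setT].

Definition local_algebra a I : set T := cstar_generated (a @` I).

Definition markov_triplet a A B C phi : Prop :=
  exists E : T -> T,
    [/\ completely_positive (local_algebra a (A `|` B `|` C))
                            (local_algebra a (A `|` B)) E,
        E 1 = 1,
        forall x y, local_algebra a A x ->
          local_algebra a (A `|` B `|` C) y -> E (x * y) = x * E y,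
        forall x, local_algebra a (A `|` B `|` C) x -> phi (E x) = phi x
      & forall x, local_algebra a (B `|` C) x -> local_algebra a B (E x)].

Definition ssa_equality a tau A B C phi : Prop :=
  entropy tau (local_algebra a (A `|` B `|` C)) phi
  - entropy tau (local_algebra a (A `|` B)) phi
  - entropy tau (local_algebra a (B `|` C)) phi
  + entropy tau (local_algebra a B) phi = 0.

Definition modular_subalgebra a tau A B C phi : set T :=
  let rho_BC := density tau (local_algebra a (B `|` C)) phi in
  [set x | local_algebra a (A `|` B) x /\
     forall t : R,
       local_algebra a (A `|` B) (ipow rho_BC t * x * ipow rho_BC (- t))].

End CAR.

(* Main.v *)
(* With N = A_AB and P = A_BC inside M = A_ABC, let rho be the density of phi on M
   and sigma its density on P.  Since tau-preserving conditional expectations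
   commute, the restriction of tau(sigma .) to N has density rho_B, so that
   equality in strong subadditivity says that restricting to N does not decrease
   the relative entropy of phi and psi = tau(sigma .).

   Let Delta y = sigma y rho^-1.  The relative entropy is determined by the numbers
   h(s) = phi((Delta + s)^-1 1), s > 0, and
     h(s) = sup_Y 2 Re phi(Y) - psi(Y Y^* ) - s phi(Y^* Y),
   the supremum over Y in M being attained only at X_s = (Delta + s)^-1 1.  Taking
   the supremum over N gives h_N <= h.  Equality of the relative entropies forces
   h = h_N (a nondecreasing function vanishing at 0 and at infinity is 0), hence
   X_s lies in N for all s, hence g(Delta) 1 = g(Delta_N) 1 for all g.

   If E is a Markov map then psi o E = psi because tau is a product over A and BC,
   and the Kadison-Schwarz inequality in the variational principle yields h <= h_N.
   The fixed points of E form an algebra in N which contains A_A and is invariant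
   under Ad sigma, hence under Ad sigma^it.  Conversely the recovery map
   x |-> rho_B^(-1/2) E_AB(sigma^(1/2) x sigma^(1/2)) rho_B^(-1/2) is a Markov map:
   it preserves phi by the identity above for the square root, and it is A_A-linear
   since Ad sigma^z and Ad rho_B^z agree on A_A. *)
Require Import Defs.
From HB Require Import structures.
From mathcomp Require Import all_boot all_order all_algebra.
From mathcomp Require Import complex.
From mathcomp Require Import all_classical all_reals all_analysis.
From mathcomp Require Import ring.

Set Implicit Arguments.
Unset Strict Implicit.
Unset Printing Implicit Defensive.

Import Order.TTheory GRing.Theory Num.Theory.
Import numFieldNormedType.Exports.

Local Open Scope classical_set_scope.
Local Open Scope ring_scope.

(** * Interpolation and moment lemmas *)

(** The obstacle is the grading: odd elements of A_A and A_BC anticommute, so A_ABC is not a tensor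
    product of commuting factors, and A_A commutes with an even rho_BC but not with every rho_BC.
    This is why the behaviour of A_A under the flow enters as a condition of its own: A_A-linearity
    of the recovery map rests on it. What survives of the tensor product is that products from A_A
    and A_BC span A_ABC and that tau is multiplicative on them. Conditional expectations are
    averages over conjugations by even elements c_l c_k, with l a mode outside A, B and C, supplied
    by the infinite chain; conjugation by c_k alone would flip the other modes and destroy
    bimodularity. No integral over s occurs. In finite dimension g(Delta) 1 - g(Delta_N) 1 is a
    finite sum of terms g(t_i) v_i: partial fractions carry information from resolvents to all g,
    and interpolation carries it between integer powers, imaginary powers and square roots. *)

Lemma interpolation (F : fieldType) (rs : seq F) (g : F -> F) :
  exists p : {poly F}, forall z, z \in rs -> p.[z] = g z.
Proof.
elim: rs => [|z rs [p pP]]; first by exists 0.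
have [zrs|zrs] := boolP (z \in rs).
  by exists p => u; rewrite inE => /orP[/eqP ->|]; exact: pP.
pose w := \prod_(u <- rs) ('X - u%:P).
exists (p + ((g z - p.[z]) / w.[z]) *: w) => u.
rewrite inE hornerD hornerZ => /orP[/eqP ->|urs].
  rewrite divfK ?subrKC //; apply: contra zrs.
  by rewrite -[_ == 0]/(root w z) root_prod_XsubC.
have /eqP -> : root w u by rewrite root_prod_XsubC.
by rewrite mulr0 addr0 pP.
Qed.

Lemma interpolation_fam (F : fieldType) (I : finType) (w g : I -> F) :
  (forall i j, w i = w j -> g i = g j) ->
  exists p : {poly F}, forall i, p.[w i] = g i.
Proof.
move=> wg.
pose h z := if [pick i | w i == z] is Some i then g i else 0.
have [p pP] := interpolation [seq w i | i <- enum I] h.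
exists p => i; rewrite pP; last by apply: map_f; rewrite mem_enum.
rewrite /h; case: pickP => [j /eqP/wg //|/(_ i)]; by rewrite eqxx.
Qed.

(** By interpolation [g] is a polynomial in [w] on the index set, so the last sum is a linear
    combination of the power sums. In the applications [w] lists eigenvalue ratios or their phases,
    and [S] is a subspace, or [[set 0]] when an identity is to be transported. *)
Lemma power_sums_determine (F : fieldType) (V : lmodType F) (S : set V)
  (I : finType) (w g : I -> F) (v : I -> V) :
  S 0 -> (forall c x y, S x -> S y -> S (c *: x + y)) ->
  (forall i j, w i = w j -> g i = g j) ->
  (forall n : nat, S (\sum_i w i ^+ n *: v i)) -> S (\sum_i g i *: v i).
Proof.
move=> S0 Slin /interpolation_fam[p pP] Sw.
have -> : \sum_i g i *: v i
    = \sum_(n < size p) p`_n *: \sum_i w i ^+ n *: v i.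
  under [RHS]eq_bigr do rewrite scaler_sumr.
  rewrite exchange_big /=; apply: eq_bigr => i _.
  rewrite -pP horner_coef scaler_suml; apply: eq_bigr => n _.
  by rewrite scalerA.
elim/big_rec: _ => // n x _ Sx; exact: Slin.
Qed.

Section Resolvents.
Context (R : realType).
Local Notation toC := (@real_complex_def R (Phant R)).

(** Partial fractions: multiplied by the product of all [s + u], the hypothesis says that a
    polynomial [P] vanishes at every positive [s]. Hence [P = 0], and evaluation at [- u] isolates
    the sum of the [c i] with [t i = u]. *)
Lemma resolvents_determine (I : finType) (t : I -> R) (c : I -> R[i])
  (g : I -> R[i]) :
  (forall i, 0 < t i) -> (forall i j, t i = t j -> g i = g j) ->
  (forall s : R, 0 < s -> \sum_i toC (s + t i)^-1 * c i = 0) ->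
  \sum_i g i * c i = 0.
Proof.
move=> t_gt0 gt res0.
(* Without repetitions, [rem (t i) U] no longer contains [t i], so the cofactor of [c i] does not
   vanish at [- t i]. *)
pose U := undup [seq t i | i <- enum I].
have tU i : t i \in U by rewrite mem_undup map_f ?mem_enum.
pose P := \sum_i c i *: \prod_(u <- rem (t i) U) ('X + (toC u)%:P).
have evP z : P.[z] = \sum_i c i * \prod_(u <- rem (t i) U) (z + toC u).
  rewrite /P horner_sum; apply: eq_bigr => i _.
  rewrite hornerZ horner_prod; congr (_ * _).
  by apply: eq_bigr => u _; rewrite hornerD hornerX hornerC.
have P0 : P = 0.
  apply/eqP; apply: contraT => Pn0.
  (* The positive points 1, ..., size P are more roots than a nonzero [P] can have. *)
  have := @max_poly_roots _ P [seq toC k.+1%:R | k <- iota 0 (size P)] Pn0.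
  rewrite size_map size_iota ltnn => ->//.
    apply/allP => _ /mapP[k _ ->]; apply/eqP; rewrite evP.
    have s0 : 0 < k.+1%:R :> R by rewrite ltr0n.
    transitivity ((\prod_(u <- U) (toC k.+1%:R + toC u))
        * \sum_i toC (k.+1%:R + t i)^-1 * c i); last by rewrite res0 // mulr0.
    rewrite mulr_sumr; apply: eq_bigr => i _.
    rewrite [X in _ = X * _](big_rem (t i)) //=.
    set w := \prod_(_ <- _) _; set x := toC _ + toC _.
    have -> : toC (k.+1%:R + t i)^-1 = x^-1.
      by rewrite /x -(rmorphD (real_complex R)) (fmorphV (real_complex R)).
    have xn0 : x != 0.
      by rewrite /x -(rmorphD (real_complex R)) fmorph_eq0 gt_eqF // addr_gt0.
    by rewrite mulrC [x * w]mulrC -mulrA mulVKf.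
  rewrite map_inj_uniq ?iota_uniq// => m n [] /eqP.
  by rewrite eqr_nat eqSS => /eqP.
have group u : u \in U -> \sum_(i | t i == u) c i = 0.
  move=> uU; have := evP (- toC u); rewrite P0 horner0.
  rewrite (bigID (fun i => t i == u)) /= [X in _ = _ + X]big1 => [|i itu].
    rewrite addr0; under eq_bigr => i /eqP -> do [].
    rewrite -mulr_suml => /esym/eqP; rewrite mulf_eq0 => /orP[/eqP //|].
    rewrite prodf_seq_eq0 => /hasP[x]; rewrite mem_rem_uniq ?undup_uniq//.
    rewrite !inE => /andP[xu _] /=.
    by rewrite addrC subr_eq0 => /eqP/complexI xeq; rewrite xeq eqxx in xu.
  rewrite (big_rem u) /=; last first.
    by rewrite mem_rem_uniq ?undup_uniq// inE eq_sym itu.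
  by rewrite addNr mul0r mulr0.
rewrite (eq_bigr (fun i => \sum_(u <- U | t i == u) g i * c i)); last first.
  move=> i _; rewrite -big_filter (@perm_big _ _ _ _ _ [:: t i]).
    by rewrite big_seq1.
  apply: uniq_perm => //; first by rewrite filter_uniq // undup_uniq.
  by move=> x; rewrite mem_filter inE eq_sym; case: eqP => // ->; rewrite tU.
rewrite (exchange_big_dep xpredT) //= big_seq big1 // => u uU.
have [[j /eqP jtu]|no] := pselect (exists j, t j == u); last first.
  by rewrite big1 // => i itu; case: no; exists i.
rewrite (eq_bigr (fun i => g j * c i)) => [|i /eqP itu].
  by rewrite -mulr_sumr group // mulr0.
by rewrite (gt i j) // itu.
Qed.

(** The resolvent sum is the derivative of G(s) = sum_i m_i ln(s + t_i). Its sign makes [G]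
    nondecreasing, the logarithmic hypothesis gives G(0) = 0, and total mass 0 gives decay at
    infinity; so [G] vanishes on the half-line, and so does its derivative. *)
Lemma log_moment_eq0 (I : finType) (t m : I -> R) :
  (forall i, 0 < t i) -> \sum_i m i = 0 ->
  (forall s : R, 0 < s -> 0 <= \sum_i (s + t i)^-1 * m i) ->
  \sum_i ln (t i) * m i = 0 ->
  forall s : R, 0 < s -> \sum_i (s + t i)^-1 * m i = 0.
Proof.
move=> t_gt0 m0 h0 l0.
pose G := \sum_i (m i *: ((@ln R) \o (fun s : R => s + t i))).
have GE s : G s = \sum_i ln (s + t i) * m i.
  by rewrite /G fct_sumE; apply: eq_bigr => i _; rewrite mulrC.
have dG (s : R) : 0 <= s -> is_derive s 1 G (\sum_i (s + t i)^-1 * m i).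
  move=> s0; rewrite /G.
  rewrite (eq_bigr (fun i => m i *: ((s + t i)^-1 * 1))); last first.
    by move=> i _; rewrite mulr1 mulrC.
  elim/big_ind2 : _ => [|f f' g g'|i _]; first exact: is_derive_cst.
    exact: is_deriveD.
  apply: is_deriveZ.
  apply: (@is_derive1_comp _ (@ln R) (fun s : R => s + t i)).
    by apply: is_derive1_ln; rewrite ltr_wpDl.
  by apply: is_derive_eq; rewrite addr0.
have ndG (x y : R) : 0 <= x -> x <= y -> G x <= G y.
  move=> x0 xy; apply: (@ger0_derive1_ndecry _ G 0) => //.
  - by move=> z; rewrite in_itv /= andbT => /ltW/dG[].
  - move=> z; rewrite in_itv /= andbT => z0; have [_] := dG z (ltW z0).
    by rewrite derive1E => ->; exact: h0.
  - apply: derivable_within_continuous => z; rewrite in_itv /= andbT.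
    by move=> /dG[].
have G0 : G 0 = 0 by rewrite GE -[RHS]l0; apply: eq_bigr => i _; rewrite add0r.
(* Decay of order 1/s: total mass 0 allows ln s to be subtracted from each logarithm, and ln(1 +
   t/s) <= t/s. *)
have Gbound (s : R) : 0 < s -> s * G s <= \sum_i t i * `|m i|.
  move=> s0; rewrite GE.
  have -> : \sum_i ln (s + t i) * m i = \sum_i ln (1 + t i / s) * m i.
    transitivity (\sum_i (ln (1 + t i / s) * m i + ln s * m i)).
      apply: eq_bigr => i _; rewrite -mulrDl -lnM ?posrE //.
        by rewrite mulrDl mul1r divfK ?gt_eqF.
      by rewrite addr_gt0 // divr_gt0.
    by rewrite big_split /= -mulr_sumr m0 mulr0 addr0.
  rewrite mulr_sumr; apply: ler_sum => i _; rewrite mulrA.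
  have ts0 : 0 < t i / s by rewrite divr_gt0.
  apply: (@le_trans _ _ (s * ln (1 + t i / s) * `|m i|)).
    apply: ler_wpM2l; rewrite ?ler_norm // mulr_ge0 ?(ltW s0) //.
    by rewrite ln_ge0 // lerDl ltW.
  apply: ler_wpM2r => //; rewrite mulrC -ler_pdivlMr //.
  by apply: le_ln1Dx; rewrite (lt_trans _ ts0) // ltrN10.
have Gle0 (s : R) : 0 <= s -> G s <= 0.
  move=> s0; rewrite leNgt; apply/negP => Gs.
  set D := \sum_i t i * `|m i| in Gbound.
  have D0 : 0 <= D by apply: sumr_ge0 => i _; rewrite mulr_ge0 // ltW.
  (* If G(s) > 0, monotonicity gives x G(s) <= x G(x) <= D for x >= s, whereas for this [x] the
     value x G(s) = s G(s) + D + G(s) exceeds D. *)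
  pose x := s + D / G s + 1.
  have x0 : 0 < x by rewrite ltr_wpDl // addr_ge0 // divr_ge0 // ltW.
  have sx : s <= x by rewrite /x -addrA lerDl addr_ge0 // divr_ge0 // ltW.
  have := le_trans (ler_wpM2l (ltW x0) (ndG _ _ s0 sx)) (Gbound _ x0).
  rewrite leNgt => /negP; apply.
  by rewrite /x !mulrDl divfK ?gt_eqF // mul1r ltr_pwDr // lerDr mulr_ge0 // ltW.
move=> s s0.
have [_ <-] := dG s (ltW s0).
rewrite (@near_eq_derive _ _ _ G (cst 0)) ?derive_cst //; last first.
  near=> x; have x0 : 0 <= x by apply/ltW; near: x; exact: lt_nbhsr.
  by apply/eqP; rewrite eq_le Gle0 //= -G0 ndG.
Unshelve. all: by end_near. Qed.
End Resolvents.

(** * Spectral theorem for finite-dimensional star-algebras *)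

Definition finite_span (F : fieldType) (V : lmodType F) (S : set V) : Prop :=
  exists n (w : 'I_n -> V), forall x, S x ->
    exists c : 'I_n -> F, x = \sum_i c i *: w i.

(** Stated for an algebra with a bare involution [st], so as to cover both [T] and the matrices over
    [T], which are given no norm. As the [p k] are nonzero, the sign of an eigenvalue can be read
    off by testing against its projection. *)
Record spectral_resolution (R : realType) (B : algType R[i]) (st : B -> B)
    (S : set B) (x : B) n (l : 'I_n -> R) (p : 'I_n -> B) : Prop :=
  SpectralResolution {
    spectral_in : forall k, S (p k);
    spectral_neq0 : forall k, p k != 0;
    spectral_star : forall k, st (p k) = p k;
    spectral_orth : forall j k, p j * p k = if j == k then p k else 0;
    spectral_sum1 : \sum_k p k = 1;
    spectral_sum : x = \sum_k (l k)%:C%C *: p k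
  }.

Section SpectralTheorem.
Context (R : realType) (B : algType R[i]) (st : B -> B) (S : set B).
Hypothesis stK : involutive st.
Hypothesis st_lin : forall (c : R[i]) x y,
  st (c *: x + y) = (c^*)%C *: st x + st y.
Hypothesis stM : forall x y, st (x * y) = st y * st x.
Hypothesis S1 : S 1.
Hypothesis Slin : forall (c : R[i]) x y, S x -> S y -> S (c *: x + y).
Hypothesis SM : forall x y, S x -> S y -> S (x * y).
Hypothesis Sdef : forall y, S y -> st y * y = 0 -> y = 0.
Hypothesis Sfin : finite_span S.

Local Lemma st0 : st 0 = 0.
Proof.
have := st_lin (-1) 0 0; rewrite scaler0 add0r => {1}->.
by rewrite rmorphN rmorph1 scaleN1r addNr.
Qed.

Local Lemma stZ c x : st (c *: x) = (c^*)%C *: st x.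
Proof. by have := st_lin c x 0; rewrite !addr0 st0 addr0. Qed.

Local Lemma stD x y : st (x + y) = st x + st y.
Proof. by have := st_lin 1 x y; rewrite rmorph1 !scale1r. Qed.

Local Lemma st1 : st 1 = 1.
Proof. by have := stM (st 1) 1; rewrite mulr1 stK mulr1 => /esym. Qed.

Local Lemma S0 : S 0.
Proof. by have := Slin (-1) S1 S1; rewrite scaleN1r addNr. Qed.

Lemma horner_alg_in x (f : {poly R[i]}) : S x -> S (horner_alg x f).
Proof.
move=> Sx; elim/poly_ind: f => [|f c IH]; first by rewrite rmorph0; exact: S0.
rewrite rmorphD rmorphM /= horner_algX horner_algC addrC.
by apply: Slin => //; exact: SM.
Qed.

Lemma horner_alg_star x (f : {poly R[i]}) : st x = x ->
  st (horner_alg x f) = horner_alg x (map_poly (@conjc R) f).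
Proof.
move=> xx; elim/poly_ind: f => [|f c IH].
  by rewrite map_poly0 !rmorph0 st0.
rewrite !rmorphD !rmorphM /= map_polyX map_polyC !horner_algX !horner_algC.
rewrite stD stZ st1 stM IH xx.
set g := map_poly _ _; congr (_ + _).
transitivity (horner_alg x ('X * g)); first by rewrite rmorphM /= horner_algX.
by rewrite mulrC rmorphM /= horner_algX.
Qed.

(** The n.+1 powers 1, x, ..., x^n lie in the span of n vectors; a linear relation between them is a
    polynomial that annihilates [x], and it splits over the complex numbers. *)
Lemma annihilating_roots x : S x ->
  exists rs : seq R[i], horner_alg x (\prod_(z <- rs) ('X - z%:P)) = 0.
Proof.
move=> Sx; have [n [w wP]] := Sfin.
have SX i : S (x ^+ i).
  by elim: i => [|i IH]; rewrite ?expr0 // exprS; exact: SM.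
pose A := \matrix_(i < n.+1, j < n) (sval (cid (wP _ (SX i)))) j.
have xA (i : 'I_n.+1) : x ^+ i = \sum_j A i j *: w j.
  by rewrite [LHS](svalP (cid (wP _ (SX i)))); under [RHS]eq_bigr do rewrite mxE.
have /rowV0Pn[v /sub_kermxP vA v0] : kermx A != 0.
  by rewrite -mxrank_eq0 mxrank_ker subn_eq0 -ltnNge ltnS rank_leq_col.
pose f := \poly_(i < n.+1) v 0 (inord i).
have fx : horner_alg x f = 0.
  rewrite /f poly_def raddf_sum /=.
  transitivity (\sum_(i < n.+1) v 0 i *: x ^+ i).
    by apply: eq_bigr => i _; rewrite linearZ /= rmorphXn /= horner_algX
      inord_val mulr_algl.
  under eq_bigr do rewrite xA scaler_sumr.
  rewrite exchange_big big1 // => j _.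
  under eq_bigr do rewrite scalerA.
  rewrite -scaler_suml; have := congr1 (fun M : 'rV_n => M 0 j) vA.
  by rewrite !mxE => ->; rewrite scale0r.
have f0 : f != 0.
  apply: contra v0 => /eqP f0; apply/eqP/rowP => i.
  have := coef_poly n.+1 (fun i => v 0 (inord i)) i.
  by rewrite -/f f0 coef0 ltn_ord inord_val mxE => <-.
have [rs frs] := closed_field_poly_normal f.
exists rs; move: fx; rewrite {1}frs linearZ /= mulr_algl.
move=> /eqP; rewrite scaler_eq0 lead_coef_eq0 (negbTE f0) => /eqP //.
Qed.

(** Take a shortest list [rs] of roots whose product polynomial annihilates x. Dropping one root z
    leaves a nonzero y with x y = z y, and definiteness of [st y * y] shows that z is real and
    occurs once. Polynomials in x are then determined by their values on [rs], and the Lagrange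
    polynomials of [rs], evaluated at x, are the spectral projections. *)
Theorem spectral_theorem x : S x -> st x = x ->
  exists n (l : 'I_n -> R) (p : 'I_n -> B), spectral_resolution st S x l p.
Proof.
move=> Sx xx; pose ev := horner_alg x.
pose P (rs : seq R[i]) := \prod_(z <- rs) ('X - z%:P).
have [rs rs0 rs_min] : exists2 rs, ev (P rs) = 0 &
    forall rs', (size rs' < size rs)%N -> ev (P rs') <> 0.
  have ex : exists n, `[< exists2 rs, ev (P rs) = 0 & size rs = n >].
    by have [rs rsP] := annihilating_roots Sx; exists (size rs); apply/asboolP; exists rs.
  case: (ex_minnP ex) => n /asboolP[rs rs0 srs] n_min.
  exists rs => // rs' lt_rs' rs'0; move: lt_rs'; rewrite srs ltnNge => /negP.
  by apply; apply: n_min; apply/asboolP; exists rs'.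
have ev_rem z : z \in rs -> x * ev (P (rem z rs)) = z *: ev (P (rem z rs)).
  move=> zrs; move: rs0; rewrite /P (perm_big _ (perm_to_rem zrs)) big_cons.
  rewrite /ev rmorphM rmorphB /= horner_algX horner_algC mulrBl => /eqP.
  by rewrite subr_eq0 mulr_algl => /eqP.
have rem_neq0 z : z \in rs -> ev (P (rem z rs)) <> 0.
  by move=> zrs; apply: rs_min; rewrite size_rem // prednK //; case: (rs) zrs.
have rs_real z : z \in rs -> (z^*)%C = z.
  move=> zrs; apply/eqP; rewrite -subr_eq0; apply/eqP.
  set y := ev (P (rem z rs)).
  have := ev_rem z zrs; rewrite -/y => xy.
  have /eqP : (z^*)%C *: (st y * y) = z *: (st y * y).
    have <- : st y * (z *: y) = z *: (st y * y) by rewrite -scalerAr.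
    have <- : st (z *: y) * y = (z^*)%C *: (st y * y) by rewrite stZ -scalerAl.
    by rewrite -xy stM xx mulrA.
  rewrite -subr_eq0 -scalerBl scaler_eq0 => /orP[/eqP //|/eqP/Sdef].
  by move=> /(_ (horner_alg_in _ Sx)) y0; case: (rem_neq0 z zrs).
(* For a double root z, y = (x - z) w while (x - z) y = 0; since x - z is self-adjoint, [st y * y]
   is the adjoint of w times (x - z) y, which is 0. *)
have rs_uniq : uniq rs.
  apply/negPn/negP => /(uniqPn 0)[i [j [ij jrs zij]]].
  pose z := rs`_i; have irs := ltn_trans ij jrs.
  have zrs : z \in rs by rewrite mem_nth.
  have zrem : z \in rem z rs.
    rewrite -has_pred1 has_count -ltnS.
    have /permP/(_ (pred1 z)) /= := perm_to_rem zrs.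
    rewrite eqxx add1n => <-; rewrite -(cat_take_drop j rs) count_cat.
    rewrite -[2%N]/(1 + 1)%N; apply: leq_add; rewrite -has_count has_pred1.
      by apply/(nthP 0); exists i; rewrite ?size_take ?jrs // nth_take.
    by rewrite (drop_nth 0) // /z zij mem_head.
  pose rs2 := rem z (rem z rs).
  have srs2 : (size rs2 < (size rs).-1)%N.
    rewrite /rs2 size_rem // size_rem // ltn_predL -(size_rem zrs).
    by case: (rem z rs) zrem.
  have PE : P (rem z rs) = ('X - z%:P) * P rs2.
    by rewrite /P (perm_big _ (perm_to_rem zrem)) big_cons.
  apply: (rem_neq0 z zrs); apply: Sdef; first exact: horner_alg_in.
  have yE : ev (P (rem z rs)) = (x - z%:A) * ev (P rs2).
    by rewrite PE /ev rmorphM rmorphB /= horner_algX horner_algC.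
  rewrite {1}yE stM -mulrA.
  have -> : st (x - z%:A) = x - z%:A.
    have -> : x - z%:A = (- z) *: 1 + x by rewrite scaleNr addrC.
    by rewrite st_lin st1 xx (raddfN (@conjc R)) /= rs_real.
  by rewrite mulrBl mulr_algl (ev_rem z zrs) subrr mulr0.
have ev_eq f g : (forall z, z \in rs -> f.[z] = g.[z]) -> ev f = ev g.
  move=> fg; apply/eqP; rewrite -subr_eq0 -rmorphB; apply/eqP.
  have [||q ->] := @uniq_roots_prod_XsubC _ (f - g) rs.
  - by apply/allP => z zrs; rewrite /root hornerD hornerN fg // subrr.
  - by rewrite uniq_rootsE.
  - by rewrite /ev rmorphM /=; move: rs0; rewrite /ev /P => ->; rewrite mulr0.
have ex_L (k : 'I_(size rs)) : exists L : {poly R[i]},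
    forall j : 'I_(size rs), L.[rs`_j] = (j == k)%:R.
  have [L LP] := interpolation rs (fun z => (z == rs`_k)%:R).
  by exists L => j; rewrite LP ?mem_nth // nth_uniq.
have [L LP] := choice ex_L.
have eqL f g : (forall j : 'I_(size rs), f.[rs`_j] = g.[rs`_j]) -> ev f = ev g.
  by move=> fg; apply: ev_eq => z /(nthP 0)[j jrs <-]; exact: (fg (Ordinal jrs)).
exists (size rs), (fun k => complex.Re rs`_k), (fun k => ev (L k)); split.
- by move=> k; exact: horner_alg_in.
(* On [rs] the product without its k-th root is a multiple of [L k]; if the latter vanished at x, a
   shorter product would annihilate x. *)
- move=> k; apply/eqP => Lk0; have zrs : rs`_k \in rs by rewrite mem_nth.
  apply: (rem_neq0 _ zrs).
  have -> : ev (P (rem rs`_k rs)) = ev ((P (rem rs`_k rs)).[rs`_k] *: L k).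
    apply: eqL => j; rewrite hornerZ LP; case: eqP => [->|/eqP jk]; first by rewrite mulr1.
    rewrite mulr0; apply/eqP; rewrite -[_ == 0]/(root _ _) /P root_prod_XsubC.
    by rewrite mem_rem_uniq // inE nth_uniq // jk mem_nth.
  by rewrite /ev linearZ /= -/ev Lk0 mulr0.
- move=> k; rewrite horner_alg_star //; apply: eqL => j.
  rewrite -[X in (map_poly _ _).[X]]rs_real ?mem_nth // horner_map /= LP.
  by rewrite rmorph_nat.
- move=> j k; rewrite /ev -rmorphM /=.
  case: eqP => [<-|/eqP jk]; last first.
    rewrite -(rmorph0 (horner_alg x)); apply: eqL => i.
    rewrite hornerM !LP horner0; case: (eqVneq i j) => [->|]; rewrite ?mul0r //.
    by rewrite (negbTE jk) mulr0.
  apply: eqL => i; rewrite hornerM LP.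
  by case: (i == j); rewrite ?mulr0 ?mulr1.
- rewrite /ev -raddf_sum -(rmorph1 (horner_alg x)); apply: eqL => j.
  rewrite horner_sum hornerC (bigD1 j) //= LP eqxx big1 ?addr0 // => i ij.
  by rewrite LP eq_sym (negbTE ij).
- transitivity (ev (\sum_(k < size rs) rs`_k *: L k)).
    rewrite -{1}(horner_algX x); apply: eqL => j.
    rewrite hornerX horner_sum (bigD1 j) //= hornerZ LP eqxx mulr1 big1 ?addr0 //.
    by move=> i ij; rewrite hornerZ LP eq_sym (negbTE ij) mulr0.
  rewrite /ev raddf_sum; apply: eq_bigr => k _ /=.
  rewrite linearZ /= mulr_algl; congr (_ *: _).
  rewrite [RHS]ReJ_add rs_real ?mem_nth //.
  by rewrite -mulr2n -[X in X / _]mulr_natr mulfK // pnatr_eq0.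
Qed.

End SpectralTheorem.

(** * Star-subalgebras and states *)

Section StarAlgebra.
Context (R : realType) (T : cstarAlgType R).
Implicit Types (S : set T) (x y : T).

Lemma starD x y : star (x + y) = star x + star y.
Proof. by have := star_semilinear 1 x y; rewrite rmorph1 !scale1r. Qed.

Lemma star0 : star (0 : T) = 0.
Proof. by apply: (addrI (star 0)); rewrite -starD !addr0. Qed.

Lemma starZ (c : R[i]) x : star (c *: x) = (c^*)%C *: star x.
Proof. by have := star_semilinear c x 0; rewrite !addr0 star0 addr0. Qed.

Lemma starN x : star (- x) = - star x.
Proof. by apply: (addrI (star x)); rewrite -starD !subrr star0. Qed.

Lemma starB x y : star (x - y) = star x - star y.
Proof. by rewrite starD starN. Qed.

Lemma star1 : star (1 : T) = 1.
Proof. by have := starM (star (1 : T)) 1; rewrite mulr1 starK mulr1 => /esym. Qed.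

Lemma star_sum (I : Type) (r : seq I) (P : pred I) (F : I -> T) :
  star (\sum_(i <- r | P i) F i) = \sum_(i <- r | P i) star (F i).
Proof. exact: (big_morph _ starD star0). Qed.

Lemma star_mul_eq0 x : star x * x = 0 -> x = 0.
Proof.
move=> xx; apply: cnorm_eq0.
have : cnorm (0 : T) = 0.
  by rewrite -(scale0r (0 : T)) cnormZ ComplexField.Normc.normc0 mul0r.
by rewrite -xx cnorm_starM => /eqP; rewrite sqrf_eq0 => /eqP.
Qed.

Definition star_subalgebra S : Prop :=
  [/\ S 1,
      forall (c : R[i]) x y, S x -> S y -> S (c *: x + y),
      forall x y, S x -> S y -> S (x * y)
    & forall x, S x -> S (star x)].

Section Closure.
Variable (S : set T).
Hypothesis Ssub : star_subalgebra S.

Lemma subalgebra1 : S 1. Proof. by case: Ssub. Qed.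

Lemma subalgebraM x y : S x -> S y -> S (x * y).
Proof. by case: Ssub => _ _ + _; exact. Qed.

Lemma subalgebra_star x : S x -> S (star x).
Proof. by case: Ssub => _ _ _; exact. Qed.

Lemma subalgebra_lin (c : R[i]) x y : S x -> S y -> S (c *: x + y).
Proof. by case: Ssub => _ + _ _; exact. Qed.

Lemma subalgebra0 : S 0.
Proof.
by have := subalgebra_lin (-1) subalgebra1 subalgebra1; rewrite scaleN1r addNr.
Qed.

Lemma subalgebraD x y : S x -> S y -> S (x + y).
Proof. by rewrite -{2}(scale1r x); exact: subalgebra_lin. Qed.

Lemma subalgebraZ (c : R[i]) x : S x -> S (c *: x).
Proof.
move=> Sx; rewrite -(addr0 (_ *: _)).
by apply: subalgebra_lin => //; exact: subalgebra0.
Qed.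

Lemma subalgebraN x : S x -> S (- x).
Proof. by rewrite -scaleN1r; exact: subalgebraZ. Qed.


Lemma subalgebra_sum (I : Type) (r : seq I) (P : pred I) (F : I -> T) :
  (forall i, P i -> S (F i)) -> S (\sum_(i <- r | P i) F i).
Proof.
move=> SF; elim/big_rec: _ => [|i x Pi Sx]; first exact: subalgebra0.
by apply: subalgebraD => //; exact: SF.
Qed.

End Closure.

End StarAlgebra.

Ltac in_subalgebra H :=
  solve [repeat first [assumption | exact (subalgebra1 H)
    | exact (subalgebra0 H) | apply: (subalgebraD H) | apply: (subalgebraN H)
    | apply: (subalgebraZ H) | apply: (subalgebraM H)
    | apply: (subalgebra_star H) | apply: (subalgebra_sum H)
    | move=> ? | done]].

Section LinearFunctionals.
Context (R : realType) (T : cstarAlgType R).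
Implicit Types (S : set T) (x y : T).

Section LinearOn.
Variables (S : set T) (f : T -> R[i]).
Hypothesis Ssub : star_subalgebra S.
Hypothesis flin : linear_on (V := R[i]^o) S f.

Lemma linear_on0 : f 0 = 0.
Proof.
have := flin (-1) (subalgebra1 Ssub) (subalgebra1 Ssub).
by rewrite scaleN1r addNr => ->; rewrite scaleN1r addNr.
Qed.

Lemma linear_onD x y : S x -> S y -> f (x + y) = f x + f y.
Proof. by move=> Sx Sy; rewrite -{1}(scale1r x) flin // scale1r. Qed.

Lemma linear_onZ c x : S x -> f (c *: x) = c * f x.
Proof.
move=> Sx; rewrite -(addr0 (c *: x)) flin ?linear_on0 ?addr0 //.
exact: subalgebra0.
Qed.

Lemma linear_onB x y : S x -> S y -> f (x - y) = f x - f y.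
Proof.
move=> Sx Sy; rewrite linear_onD //; last exact: subalgebraN.
by rewrite -scaleN1r linear_onZ // mulN1r.
Qed.


End LinearOn.

(** [f] is real on [star y * y] for y = 1 + c x; the choices c = 1 and c = 'i give two real
    equations that identify f(star x). *)
Lemma state_on_star S (f : T -> R[i]) x :
  star_subalgebra S -> state_on S f -> S x -> f (star x) = (f x)^*%C.
Proof.
move=> Ssub [flin fpos f1] Sx.
have Ssx := subalgebra_star Ssub Sx; have S1 := subalgebra1 Ssub.
have Sxx := subalgebraM Ssub Ssx Sx.
have real y : S y -> complex.Im (f (star y * y)) = 0.
  by move=> Sy; exact/ger0_Im/fpos.
have sumE c : complex.Im ((c^*)%C * f (star x) + c * f x) = 0.
  have Sc := subalgebraZ Ssub c Sx.
  have Scs := subalgebra_star Ssub Sc.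
  have := real (1 + c *: x) (subalgebraD Ssub S1 Sc).
  rewrite starD star1 mulrDl mul1r mulrDr mulr1.
  rewrite !(linear_onD flin) //; try in_subalgebra Ssub.
  rewrite f1 starZ !(linear_onZ Ssub flin) //; try in_subalgebra Ssub.
  have -> : f ((c^*)%C *: star x * (c *: x)) = (c^*)%C * c * f (star x * x).
    by rewrite -scalerAl -scalerAr !(linear_onZ Ssub flin) ?mulrA //;
      in_subalgebra Ssub.
  move: (real x Sx) => im0; rewrite -(addrA 1) => im1.
  move: im0 im1; move: {Sc Scs} c => [p q].
  case: (f (star x)) => u v; case: (f x) => r s; case: (f (star x * x)) => m n /= ->.
  move=> <-; ring.
have := sumE 1; have := sumE 'i%C.
case: (f (star x)) => u v; case: (f x) => r s /= e1 e2.
congr (_ +i* _)%C; first by apply/eqP; rewrite -subr_eq0 -oppr_eq0 -e1; apply/eqP; ring.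
by apply/eqP; rewrite -subr_eq0 -e2; apply/eqP; ring.
Qed.


Lemma star_subalgebraT : star_subalgebra [set: T]. Proof. by []. Qed.

End LinearFunctionals.

(** * Bounded additive maps and norm limits *)

Section Norm.
Context (R : realType) (T : cstarAlgType R).
Implicit Types (x y : T) (u : nat -> T) (f g : T -> T).

Lemma cnorm0 : cnorm (0 : T) = 0.
Proof. by rewrite -(scale0r (0 : T)) cnormZ ComplexField.Normc.normc0 mul0r. Qed.

Lemma cnormN x : cnorm (- x) = cnorm x.
Proof.
rewrite -scaleN1r cnormZ; have -> : ComplexField.Normc.normc (-1 : R[i]) = 1.
  by rewrite /= sqrrN expr1n oppr0 expr0n addr0 sqrtr1.
by rewrite mul1r.
Qed.

Lemma cnorm_ge0 x : 0 <= cnorm x.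
Proof.
by have := cnormD_le x (- x); rewrite subrr cnorm0 cnormN -mulr2n pmulrn_lge0.
Qed.

(** Just enough to pass an algebraic identity to norm limits; meant for [drop_mode], which computes
    the coefficients of the Clifford normal form. *)
Definition bounded_additive f : Prop :=
  (forall x y, f (x - y) = f x - f y) /\
  exists C, forall x, cnorm (f x) <= C * cnorm x.

Lemma bounded_additive_id : bounded_additive id.
Proof. by split=> //; exists 1 => x; rewrite mul1r. Qed.

Lemma bounded_additiveD f g : bounded_additive f -> bounded_additive g ->
  bounded_additive (fun x => f x + g x).
Proof.
move=> [fB [C fC]] [gB [D gD]]; split.
  by move=> x y; rewrite fB gB opprD addrACA.
exists (C + D) => x; apply: (le_trans (cnormD_le _ _)).
by rewrite mulrDl lerD.
Qed.

Lemma bounded_additiveZ c f : bounded_additive f ->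
  bounded_additive (fun x => c *: f x).
Proof.
move=> [fB [C fC]]; split; first by move=> x y; rewrite fB scalerBr.
exists (ComplexField.Normc.normc c * C) => x; rewrite cnormZ -mulrA.
apply: ler_wpM2l => //.
by case: c => a b; rewrite /= sqrtr_ge0.
Qed.

Lemma bounded_additive_comp f g : bounded_additive f -> bounded_additive g ->
  bounded_additive (f \o g).
Proof.
move=> [fB [C fC]] [gB [D gD]]; split; first by move=> x y /=; rewrite gB fB.
exists (`|C| * D) => x /=; apply: (le_trans (fC _)).
apply: (@le_trans _ _ (`|C| * cnorm (g x))).
  by apply: ler_wpM2r; rewrite ?cnorm_ge0 // ler_norm.
by rewrite -mulrA; apply: ler_wpM2l.
Qed.

Lemma bounded_additiveMl z f : bounded_additive f ->
  bounded_additive (fun x => z * f x).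
Proof.
apply: (@bounded_additive_comp (fun x => z * x)); split.
  by move=> x y; rewrite mulrBr.
by exists (cnorm z) => x; exact: cnormM_le.
Qed.

Lemma bounded_additiveMr z f : bounded_additive f ->
  bounded_additive (fun x => f x * z).
Proof.
apply: (@bounded_additive_comp (fun x => x * z)); split.
  by move=> x y; rewrite mulrBl.
by exists (cnorm z) => x; rewrite mulrC; exact: cnormM_le.
Qed.

Lemma bounded_additive_cvg f u l : bounded_additive f ->
  (fun n => cnorm (u n - l)) @ \oo --> (0 : R) ->
  (fun n => cnorm (f (u n) - f l)) @ \oo --> (0 : R).
Proof.
move=> [fB [C fC]] ul.
apply: (@squeeze_cvgr _ _ _ _ (fun=> 0) (fun n => C * cnorm (u n - l))).
- by apply: nearW => n; rewrite cnorm_ge0 -fB fC.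
- exact: cvg_cst.
- by rewrite -[X in _ --> X](mulr0 C); apply: cvgMl_tmp.
Qed.

Lemma bounded_additive_eq0 f u l : bounded_additive f ->
  (forall n, f (u n) = 0) ->
  (fun n => cnorm (u n - l)) @ \oo --> (0 : R) -> f l = 0.
Proof.
move=> bf fu /(bounded_additive_cvg bf) h; apply: cnorm_eq0.
have : (fun=> cnorm (f l)) @ \oo --> (0 : R).
  by apply: cvg_trans h; apply: near_eq_cvg; apply: nearW => n; rewrite fu sub0r cnormN.
by move/(cvg_lim (@Rhausdorff R)); rewrite lim_cst.
Qed.

(** Base case of [clifford_closed]. The distance of two coefficients times [cnorm 1] is the distance
    of the scalars, so the coefficients are Cauchy, and their real and imaginary parts converge. *)
Lemma norm_closed_scalars : (1 : T) != 0 ->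
  norm_closed [set x : T | exists z : R[i], x = z%:A].
Proof.
move=> one0 u l /choice[z zP] ul.
have n1 : 0 < cnorm (1 : T).
  by rewrite lt_neqAle cnorm_ge0 andbT eq_sym; apply: contra one0 => /eqP/cnorm_eq0 ->.
have zB m n : ComplexField.Normc.normc (z m - z n) * cnorm (1 : T)
    <= cnorm (u m - l) + cnorm (u n - l).
  rewrite -cnormZ scalerBl -!zP -(cnormN (u n - l)).
  by apply: le_trans (cnormD_le _ _); rewrite opprB addrA subrK.
have cauchy (h : R[i] -> R) : (forall x y : R[i], h (x - y) = h x - h y) ->
    (forall x : R[i], `|h x| <= ComplexField.Normc.normc x) ->
    cvg ((h \o z) @ \oo).
  move=> hB hle; apply/cauchy_cvgP/cauchy_exP => e e0.
  have e1 : 0 < e * cnorm (1 : T) / 2 by rewrite divr_gt0 // mulr_gt0.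
  have /cvgrPdist_lt/(_ _ e1)[N _ uN] := ul.
  exists (h (z N)); exists N => // n Nn.
  rewrite /ball /= -hB (le_lt_trans (hle _)) // -(ltr_pM2r n1).
  apply: (le_lt_trans (zB _ _)); rewrite [ltRHS]splitr ltrD //.
    by have := uN N (leqnn N); rewrite /= sub0r normrN ger0_norm ?cnorm_ge0.
  by have := uN n Nn; rewrite /= sub0r normrN ger0_norm ?cnorm_ge0.
have re_le (x : R[i]) : `|complex.Re x| <= ComplexField.Normc.normc x.
  by case: x => a b /=; rewrite -sqrtr_sqr ler_wsqrtr // lerDl sqr_ge0.
have im_le (x : R[i]) : `|complex.Im x| <= ComplexField.Normc.normc x.
  by case: x => a b /=; rewrite -sqrtr_sqr ler_wsqrtr // lerDr sqr_ge0.
have /cvg_ex[p zp] := cauchy (@complex.Re R)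
  (fun v w => raddfB (@complex.Re R : Rcomplex R -> R) v w) re_le.
have /cvg_ex[q zq] := cauchy (@complex.Im R)
  (fun v w => raddfB (@complex.Im R : Rcomplex R -> R) v w) im_le.
exists (p +i* q)%C; apply/eqP; rewrite -subr_eq0; apply/eqP/cnorm_eq0.
pose b n := cnorm (u n - l) +
  (`|p - complex.Re (z n)| + `|q - complex.Im (z n)|) * cnorm (1 : T).
have lb n : cnorm (l - (p +i* q)%C%:A) <= b n.
  rewrite -(subrK (u n) l) -addrA; apply: le_trans (cnormD_le _ _) _.
  rewrite -cnormN opprB lerD2l zP -scalerBl cnormZ ler_wpM2r ?cnorm_ge0 //.
  case: (z n) => x y /=; rewrite (distrC p) (distrC q).
  rewrite -[leRHS]ger0_norm ?addr_ge0 // -sqrtr_sqr ler_wsqrtr //.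
  rewrite [leRHS]sqrrD !real_normK ?num_real // addrAC lerDl.
  by rewrite mulrn_wge0 // mulr_ge0.
have b0 : b @ \oo --> (0 : R).
  rewrite -[X in _ --> X](addr0 0); apply: cvgD => //.
  rewrite -[X in _ --> X](mul0r (cnorm (1 : T))); apply: cvgMr_tmp.
  rewrite -[X in _ --> X](addr0 0); apply: cvgD; rewrite -[X in _ --> X](normr0 R).
    by apply: cvg_norm; rewrite -[X in _ --> X](subrr p); apply: cvgB => //; exact: cvg_cst.
  by apply: cvg_norm; rewrite -[X in _ --> X](subrr q); apply: cvgB => //; exact: cvg_cst.
apply/eqP; rewrite eq_le cnorm_ge0 andbT.
rewrite leNgt; apply/negP => /(cvgr_lt _ b0)[N _ /(_ N (leqnn N))] /=.
by rewrite ltNge lb.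
Qed.

End Norm.

(** * Algebras generated by anticommuting self-adjoint unitaries *)

Section Clifford.
Context (R : realType) (T : cstarAlgType R) (J : eqType) (c : J -> T).
Hypothesis c_star : forall k, star (c k) = c k.
Hypothesis c_sqr : forall k, c k * c k = 1.
Hypothesis c_anti : forall k l, k != l -> c k * c l = - (c l * c k).
Hypothesis c_fresh : forall K : seq J, exists l, l \notin K.
Implicit Types (x y u v : T) (k l : J) (K L : seq J).

(** The normal form u + c_k v, one mode at a time, of an element of the algebra generated by the
    [c k]. It turns multiplication, closedness, faithfulness of the trace and the Riesz lemma into
    inductions on the list. *)
Fixpoint clifford K : set T :=
  if K is k :: K' then
    [set x | exists u v, [/\ clifford K' u, clifford K' v & x = u + c k * v]]
  else [set x | exists z : R[i], x = z%:A].

Lemma clifford_lin K (z : R[i]) x y :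
  clifford K x -> clifford K y -> clifford K (z *: x + y).
Proof.
elim: K x y => [|k K IH] x y /=.
  by move=> [p ->] [q ->]; exists (z * p + q); rewrite scalerDl scalerA.
move=> [u [v [Ku Kv ->]]] [u' [v' [Ku' Kv' ->]]].
exists (z *: u + u'), (z *: v + v'); split; [exact: IH|exact: IH|].
by rewrite scalerDr addrACA mulrDr scalerAr.
Qed.

Lemma clifford1 K : clifford K 1.
Proof.
elim: K => [|k K IH] /=; first by exists 1; rewrite scale1r.
exists 1, 0; split=> //; last by rewrite mulr0 addr0.
by have := clifford_lin (-1) IH IH; rewrite scaleN1r addNr.
Qed.

Lemma clifford0 K : clifford K 0.
Proof.
by have := clifford_lin (-1) (clifford1 K) (clifford1 K); rewrite scaleN1r addNr.
Qed.

Lemma cliffordN K x : clifford K x -> clifford K (- x).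
Proof.
by move=> Kx; have := clifford_lin (-1) Kx (clifford0 K); rewrite scaleN1r addr0.
Qed.

Lemma cliffordD K x y : clifford K x -> clifford K y -> clifford K (x + y).
Proof. by move=> Kx Ky; have := clifford_lin 1 Kx Ky; rewrite scale1r. Qed.

Lemma clifford_cons k K x : clifford K x -> clifford (k :: K) x.
Proof. by exists x, 0; split=> //; [exact: clifford0|rewrite mulr0 addr0]. Qed.

Lemma clifford_gen K k : k \in K -> clifford K (c k).
Proof.
elim: K => // j K IH; rewrite inE => /orP[/eqP ->|/IH]; last exact: clifford_cons.
by exists 0, 1; split; [exact: clifford0|exact: clifford1|rewrite mulr1 add0r].
Qed.

(* The automorphism c_k |-> - c_k of clifford K. *)
Lemma clifford_parity K x : clifford K x ->
  exists2 x', clifford K x' & forall l, l \notin K -> x * c l = c l * x'.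
Proof.
elim: K x => [|k K IH] x /=.
  by move=> [z ->]; exists z%:A; [exists z|move=> l _; rewrite mulr_algl mulr_algr].
move=> [u [v [/IH[u' Ku' uu'] /IH[v' Kv' vv'] ->]]].
exists (u' - c k * v').
  by exists u', (- v'); split=> //; [exact: cliffordN|rewrite mulrN].
move=> l; rewrite inE negb_or => /andP[lk lK].
rewrite mulrDl uu' // -mulrA vv' // mulrA c_anti 1?eq_sym //.
by rewrite mulNr -mulrA mulrBr.
Qed.

Lemma cliffordM K x y : uniq K ->
  clifford K x -> clifford K y -> clifford K (x * y).
Proof.
elim: K x y => [|k K IH] x y /=.
  by move=> _ [p ->] [q ->]; exists (p * q); rewrite mulr_algl scalerA.
move=> /andP[kK uK] [u [v [Ku Kv ->]]] [w [z [Kw Kz ->]]].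
have [u' Ku' /(_ k kK) uu'] := clifford_parity Ku.
have [v' Kv' /(_ k kK) vv'] := clifford_parity Kv.
exists (u * w + v' * z), (u' * z + v * w).
split; [by apply: cliffordD; apply: IH|by apply: cliffordD; apply: IH|].
rewrite !mulrDl !mulrDr mulrA uu' -!addrA; congr (_ + _).
rewrite -[c k * v * (c k * z)]mulrA [v * (c k * z)]mulrA vv' -!mulrA.
by rewrite [c k * (c k * _)]mulrA c_sqr mul1r [in RHS]addrC -!addrA.
Qed.

Lemma clifford_star K x : uniq K -> clifford K x -> clifford K (star x).
Proof.
elim: K x => [|k K IH] x /=.
  by move=> _ [z ->]; exists (z^*)%C; rewrite starZ star1.
move=> /andP[kK uK] [u [v [Ku Kv ->]]].
have [v' Kv' /(_ k kK) vv'] := clifford_parity (IH _ uK Kv).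
exists (star u), v'; split=> //; first exact: IH.
by rewrite starD starM c_star vv'.
Qed.

Lemma clifford_subalgebra K : uniq K -> star_subalgebra (clifford K).
Proof.
move=> uK; split; first exact: clifford1.
- by move=> z x y; exact: clifford_lin.
- by move=> x y; exact: cliffordM.
- by move=> x; exact: clifford_star.
Qed.

Lemma clifford_span K : finite_span (clifford K).
Proof.
elim: K => [|k K [n [w wP]]] /=.
  exists 1%N, (fun=> 1) => x [z ->]; exists (fun=> z).
  by rewrite big_ord1.
exists (n + n)%N, (fun i =>
  match fintype.split i with inl j => w j | inr j => c k * w j end).
move=> _ [u [v [/wP[d ->] /wP[e ->] ->]]].
exists (fun i => match fintype.split i with inl j => d j | inr j => e j end).
rewrite big_split_ord /=; congr (_ + _).
  by apply: eq_bigr => i _; rewrite (unsplitK (inl i)).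
rewrite mulr_sumr; apply: eq_bigr => i _; rewrite (unsplitK (inr i)).
by rewrite scalerAr.
Qed.

(** Stands in for the decomposition of a tensor product into sums of simple tensors. *)
Lemma clifford_cat_ind K L (P : T -> Prop) :
  (forall x y, clifford K x -> clifford L y -> P (x * y)) ->
  (forall x y, P x -> P y -> P (x + y)) ->
  forall z, clifford (K ++ L) z -> P z.
Proof.
elim: K P => [|k K IH] P PM PD z /=.
  by move=> Lz; rewrite -(mul1r z); apply: PM => //; exists 1; rewrite scale1r.
move=> [u [v [Ku Kv ->]]]; apply: (PD).
  apply: (IH P _ PD u Ku) => x y Kx Ly; apply: (PM x y) => //.
  exact: (@clifford_cons k).
(* The mode [k] is absorbed into the predicate, which the induction keeps general for this
   purpose. *)
apply: (IH (fun v => P (c k * v)) _ _ v Kv); last first.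
  by move=> x y Px Py; rewrite mulrDr; exact: PD.
move=> x y Kx Ky; rewrite mulrA; apply: PM => //.
by exists 0, x; split=> //; [exact: clifford0|rewrite add0r].
Qed.

(* Conjugation by c_l c_k flips c_k and fixes c_j for j <> k, l. Averaging
   over it removes c_k. *)
Definition drop_mode l k x : T :=
  (2^-1 : R[i]) *: (x + c l * c k * x * (c k * c l)).

Lemma drop_mode_lin l k (z : R[i]) x y :
  drop_mode l k (z *: x + y) = z *: drop_mode l k x + drop_mode l k y.
Proof.
rewrite /drop_mode mulrDr mulrDl -scalerAr -scalerAl addrACA -scalerDr.
by rewrite [LHS]scalerDr !scalerA [z * _]mulrC.
Qed.

Lemma cc1 k l : c k * c l * (c l * c k) = 1.
Proof. by rewrite -mulrA (mulrA (c l)) c_sqr mul1r c_sqr. Qed.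

Lemma half2 (x : T) : (2^-1 : R[i]) *: (x + x) = x.
Proof. by rewrite -mulr2n -(scaler_nat 2 x) scalerA mulVf ?scale1r // pnatr_eq0. Qed.

Lemma drop_mode1 l k : drop_mode l k 1 = 1.
Proof. by rewrite /drop_mode mulr1 cc1 half2. Qed.

Lemma drop_mode_star l k x : star (drop_mode l k x) = drop_mode l k (star x).
Proof.
rewrite /drop_mode starZ starD !starM !c_star mulrA.
by rewrite conjc_inv conjc_nat !mulrA.
Qed.

Lemma clifford_comm2 K l k x : clifford K x -> l \notin K -> k \notin K ->
  x * (c l * c k) = c l * c k * x.
Proof.
move=> Kx lK kK; have [x' Kx' xx'] := clifford_parity Kx.
have -> : x * (c l * c k) = c l * (x' * c k) by rewrite mulrA xx' // mulrA.
rewrite -mulrA; congr (_ * _).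
have -> : x' = c k * x * c k by rewrite -mulrA xx' // mulrA c_sqr mul1r.
by rewrite -mulrA c_sqr mulr1.
Qed.

Lemma drop_modeMl K l k x y : clifford K y -> l \notin K -> k \notin K ->
  drop_mode l k (y * x) = y * drop_mode l k x.
Proof.
move=> Ky lK kK; rewrite /drop_mode -scalerAr mulrDr !mulrA.
by rewrite -[y * c l * c k]mulrA (clifford_comm2 Ky) // !mulrA.
Qed.

Lemma drop_modeMr K l k x y : clifford K y -> l \notin K -> k \notin K ->
  drop_mode l k (x * y) = drop_mode l k x * y.
Proof.
move=> Ky lK kK; rewrite /drop_mode -scalerAl mulrDl.
by rewrite -[_ * (c k * c l) * y]mulrA -(clifford_comm2 Ky) // !mulrA.
Qed.

Lemma drop_mode_id K l k x : clifford K x -> l \notin K -> k \notin K ->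
  drop_mode l k x = x.
Proof. by move=> Kx lK kK; rewrite -{1}(mulr1 x) (drop_modeMl _ Kx) // drop_mode1 mulr1. Qed.

Lemma drop_mode_gen l k : l != k -> drop_mode l k (c k) = 0.
Proof.
move=> lk; rewrite /drop_mode -(mulrA (c l)) c_sqr mulr1 mulrA (c_anti lk).
by rewrite mulNr -mulrA c_sqr mulr1 subrr scaler0.
Qed.

(** Makes the coefficient [u] a bounded function of the element, and [v] as well: multiplication by
    c_k exchanges the two, as c_k squares to 1. *)
Lemma drop_mode_cons K l k u v : clifford K u -> clifford K v ->
  l \notin k :: K -> k \notin K -> drop_mode l k (u + c k * v) = u.
Proof.
move=> Ku Kv; rewrite inE negb_or => /andP[lk lK] kK.
have := drop_mode_lin l k 1 u (c k * v); rewrite !scale1r => ->.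
by rewrite (drop_mode_id Ku) // (drop_modeMr _ Kv) // drop_mode_gen // mul0r addr0.
Qed.

Lemma bounded_drop_mode l k : bounded_additive (drop_mode l k).
Proof.
apply: bounded_additiveZ; apply: bounded_additiveD; first exact: bounded_additive_id.
apply: bounded_additiveMr; apply: bounded_additiveMl; exact: bounded_additive_id.
Qed.

(** The coefficients of the normal form converge because [drop_mode] is bounded, and by induction
    their limits lie in the smaller algebra. The identity x = D(x) + c_k D(c_k x) holds along the
    sequence and passes to the limit. *)
Lemma clifford_closed K : uniq K -> norm_closed (clifford K).
Proof.
elim: K => [_|k K IH /= /andP[kK uK]] /=.
  by apply: norm_closed_scalars; exact: oner_neq0.
move=> s x sK sx.
have [l lkK] := c_fresh (k :: K).
pose D := drop_mode l k; have bD : bounded_additive D by exact: bounded_drop_mode.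
have bDc : bounded_additive (fun y => D (c k * y)).
  apply: (bounded_additive_comp bD).
  apply: bounded_additiveMl; exact: bounded_additive_id.
have Dcons n : exists2 uv : T * T, clifford K uv.1 /\ clifford K uv.2 &
    [/\ s n = uv.1 + c k * uv.2, D (s n) = uv.1 & D (c k * s n) = uv.2].
  have [u [v [Ku Kv sE]]] := sK n; exists (u, v) => //=; split=> //.
    by rewrite sE /D (drop_mode_cons Ku Kv).
  rewrite sE mulrDr mulrA c_sqr mul1r addrC.
  by rewrite /D (drop_mode_cons Kv Ku).
exists (D x), (D (c k * x)); split.
- apply: (IH uK (fun n => D (s n))); last exact: bounded_additive_cvg.
  by move=> n; have [uv [Ku Kv] [_ -> _]] := Dcons n.
- apply: (IH uK (fun n => D (c k * s n))); last exact: (bounded_additive_cvg bDc).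
  by move=> n; have [uv [Ku Kv] [_ _ ->]] := Dcons n.
- apply/eqP; rewrite -subr_eq0; apply/eqP.
  pose f y := y + (-1) *: (D y + c k * D (c k * y)).
  have bf : bounded_additive f.
    apply: bounded_additiveD; first exact: bounded_additive_id.
    apply: bounded_additiveZ; apply: bounded_additiveD => //.
    exact: (bounded_additiveMl (c k) bDc).
  rewrite -scaleN1r; apply: (bounded_additive_eq0 bf _ sx) => n.
  by have [uv _ [sE DE DcE]] := Dcons n; rewrite /f DE DcE scaleN1r sE subrr.
Qed.

(** The tau-preserving conditional expectation that forgets the modes in [L]; one auxiliary mode [l]
    serves for all of them. *)
Definition condexp l L x : T := foldl (fun y k => drop_mode l k y) x L.

Lemma condexp_lin l L (z : R[i]) x y :
  condexp l L (z *: x + y) = z *: condexp l L x + condexp l L y.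
Proof. by elim: L x y => //= k L IH x y; rewrite drop_mode_lin IH. Qed.

Lemma condexp_star l L x : star (condexp l L x) = condexp l L (star x).
Proof. by elim: L x => //= k L IH x; rewrite IH drop_mode_star. Qed.

Lemma condexpMl K l L x y : clifford K y -> l \notin K ->
  {in L, forall k, k \notin K} -> condexp l L (y * x) = y * condexp l L x.
Proof.
move=> Ky lK; elim: L x => //= k L IH x LK.
rewrite (drop_modeMl _ Ky) //; last by apply: LK; exact: mem_head.
by apply: IH => j jL; apply: LK; rewrite inE jL orbT.
Qed.

Lemma condexpMr K l L x y : clifford K y -> l \notin K ->
  {in L, forall k, k \notin K} -> condexp l L (x * y) = condexp l L x * y.
Proof.
move=> Ky lK; elim: L x => //= k L IH x LK.
rewrite (drop_modeMr _ Ky) //; last by apply: LK; exact: mem_head.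
by apply: IH => j jL; apply: LK; rewrite inE jL orbT.
Qed.


Lemma condexp_in K l L x : uniq (L ++ K) -> l \notin L ++ K ->
  clifford (L ++ K) x -> clifford K (condexp l L x).
Proof.
elim: L x => //= k L IH x /andP[kLK uLK] lkLK [u [v [Ku Kv ->]]].
rewrite (drop_mode_cons Ku Kv) //; apply: IH => //.
by apply: contra lkLK; rewrite inE orbC => ->.
Qed.

Section Trace.
Variable tau : T -> R[i].
Hypothesis tau_tracial : tracial_state tau.

Let tau_state : state_on setT tau := tau_tracial.1.
Let tau_lin : linear_on (V := R[i]^o) setT tau.
Proof. by case: tau_state. Qed.
Let tauD x y : tau (x + y) = tau x + tau y.
Proof. exact: (linear_onD tau_lin). Qed.
Let tauZ z x : tau (z *: x) = z * tau x.
Proof. exact: (linear_onZ (star_subalgebraT T) tau_lin). Qed.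
Let tauC x y : tau (x * y) = tau (y * x).
Proof. exact: tau_tracial.2. Qed.

Lemma trace_drop_mode l k x : tau (drop_mode l k x) = tau x.
Proof.
rewrite /drop_mode tauZ tauD tauC mulrA.
by rewrite cc1 mul1r -mulr2n -(mulr_natl (tau x)) mulKf // pnatr_eq0.
Qed.

Lemma trace_condexp l L x : tau (condexp l L x) = tau x.
Proof. by elim: L x => //= k L IH x; rewrite IH trace_drop_mode. Qed.

(** Averaging over the modes of [K] preserves the trace, lets [y] out to the right and turns [x]
    into a scalar, which must be tau(x). *)
Lemma trace_prod K L x y : uniq (K ++ L) -> clifford K x -> clifford L y ->
  tau (x * y) = tau x * tau y.
Proof.
move=> uKL Kx Ly; have [l lKL] := c_fresh (K ++ L).
have /andP[uK /andP[/hasPn LK uL]] : uniq K && (~~ has (mem K) L && uniq L).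
  by rewrite -cat_uniq.
have [lK lL] : l \notin K /\ l \notin L.
  by move: lKL; rewrite mem_cat negb_or => /andP.
rewrite -(trace_condexp l K) (condexpMr _ Ly) //; last first.
  by move=> k kK; apply/negP => /LK/negP; apply.
have [|||z xz] := @condexp_in [::] l K x; rewrite ?cats0 //.
have := trace_condexp l K x; rewrite xz mulr_algl !tauZ => <-.
by case: tau_state => _ _ ->; rewrite mulr1.
Qed.

Lemma trace_gen k K v : uniq (k :: K) -> clifford K v -> tau (c k * v) = 0.
Proof.
move=> /= /andP[kK uK] Kv; have [l lkK] := c_fresh (k :: K).
have := drop_mode_cons (clifford0 K) Kv lkK kK; rewrite add0r => e.
rewrite -(trace_drop_mode l k) e.
exact: (linear_on0 (star_subalgebraT T) tau_lin).
Qed.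

(** The parts u and c_k v are orthogonal for the trace, so the square norm of x is the sum of those
    of [u] and [v]. *)
Lemma trace_faithful K x : uniq K -> clifford K x -> tau (star x * x) = 0 -> x = 0.
Proof.
elim: K x => [|k K IH] x.
  move=> _ [z ->]; rewrite starZ star1 -scalerAl mul1r scalerA tauZ.
  case: tau_state => _ _ ->; rewrite mulr1 => /eqP.
  by rewrite mulf_eq0 conjc_eq0 orbb => /eqP ->; rewrite scale0r.
move=> /= /andP[kK uK] [u [v [Ku Kv ->]]].
have Ksv := clifford_star uK Kv; have Ksu := clifford_star uK Ku.
have cross y z : clifford K y -> clifford K z -> tau (y * (c k * z)) = 0.
  move=> Ky Kz; rewrite tauC -mulrA; apply: (@trace_gen k K) => /=; rewrite ?kK //.
  exact: cliffordM.
rewrite starD starM c_star mulrDl !mulrDr !tauD cross // addr0.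
have -> : tau (star v * c k * u) = 0 by rewrite -mulrA cross.
rewrite add0r -mulrA [c k * (c k * v)]mulrA c_sqr mul1r.
have [_ tpos _] := tau_state; move=> /eqP.
rewrite paddr_eq0 ?tpos // => /andP[/eqP/IH -> // /eqP/IH -> //].
by rewrite mulr0 addr0.
Qed.

(** If [r] represents f and [s] represents v |-> f(c_k v) on the smaller algebra, then r + c_k s'
    represents f, where s' is the parity image of [s]: c_k s' = s c_k, and the two factors c_k
    cancel. *)
Lemma riesz K (f : T -> R[i]) : uniq K -> linear_on (V := R[i]^o) (clifford K) f ->
  exists2 rho, clifford K rho & forall x, clifford K x -> f x = tau (rho * x).
Proof.
elim: K f => [|k K IH] f.
  move=> uK flin; exists (f 1)%:A; first by exists (f 1).
  move=> _ [z ->]; rewrite mulr_algl !tauZ.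
  case: tau_state => _ _ ->; rewrite mulr1.
  have S1 : clifford [::] 1 by exact: clifford1.
  have := flin z _ _ S1 (clifford0 [::]).
  by rewrite addr0 (linear_on0 (clifford_subalgebra uK) flin) addr0 mulrC.
move=> ukK; have /andP[kK uK] := ukK => flin.
have fc_lin : linear_on (V := R[i]^o) (clifford K) (fun v => f (c k * v)).
  move=> z x y Kx Ky; rewrite mulrDr -scalerAr flin //.
    by exists 0, x; split=> //; [exact: clifford0|rewrite add0r].
  by exists 0, y; split=> //; [exact: clifford0|rewrite add0r].
have f_lin : linear_on (V := R[i]^o) (clifford K) f.
  by move=> z x y Kx Ky; apply: flin; exact: clifford_cons.
have [r Kr rP] := IH _ uK f_lin; have [s Ks sP] := IH _ uK fc_lin.
have [s' Ks' /(_ k kK) ss'] := clifford_parity Ks.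
exists (r + c k * s'); first by exists r, s'.
move=> _ [u [v [Ku Kv ->]]].
rewrite (linear_onD flin); last 2 first.
- exact: clifford_cons.
- by exists 0, v; split=> //; [exact: clifford0|rewrite add0r].
rewrite rP // sP // mulrDl !mulrDr !tauD.
have cross y z : clifford K y -> clifford K z -> tau (y * (c k * z)) = 0.
  move=> Ky Kz; rewrite tauC -mulrA; apply: (@trace_gen k K) => //.
  exact: cliffordM.
rewrite cross // addr0 -mulrA (@trace_gen k K) //; last exact: cliffordM.
by rewrite add0r -ss' -mulrA [c k * (c k * v)]mulrA c_sqr mul1r.
Qed.

End Trace.

End Clifford.

(** * Majorana generators and the local algebras *)

Section CARmodes.
Context (R : realType) (T : cstarAlgType R) (a : int -> T).
Hypothesis car : is_CAR a.

(** Up to real factors, the real and imaginary parts of a_i: self-adjoint unitaries that anticommute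
    pairwise, two per site, to which the Clifford section applies. *)
Definition majorana (k : int * bool) : T :=
  if k.2 then 'i%C *: (a k.1 - star (a k.1)) else a k.1 + star (a k.1).

Let ac (x y : T) := x * y + y * x.

Let acC x y : ac x y = ac y x. Proof. by rewrite /ac addrC. Qed.

Let acDl x y z : ac (x + y) z = ac x z + ac y z.
Proof. by rewrite /ac mulrDl mulrDr addrACA. Qed.

Let acDr x y z : ac z (x + y) = ac z x + ac z y.
Proof. by rewrite acC acDl !(acC z). Qed.

Let acZl (c : R[i]) x y : ac (c *: x) y = c *: ac x y.
Proof. by rewrite /ac scalerDr scalerAl scalerAr. Qed.

Let acZr (c : R[i]) x y : ac x (c *: y) = c *: ac x y.
Proof. by rewrite acC acZl acC. Qed.

Let acNl x y : ac (- x) y = - ac x y.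
Proof. by rewrite -scaleN1r acZl scaleN1r. Qed.

Let acNr x y : ac x (- y) = - ac x y.
Proof. by rewrite acC acNl acC. Qed.

Lemma majorana_anticomm k l :
  ac (majorana k) (majorana l) = if k == l then 2%:R else 0.
Proof.
have [aa as_ _] := car.
have ss i j : ac (star (a i)) (star (a j)) = 0.
  by rewrite /ac -!starM -starD addrC aa star0.
have sa i j : ac (star (a i)) (a j) = (i == j)%:R.
  by rewrite acC /ac as_ eq_sym.
have aa' i j : ac (a i) (a j) = 0 := aa i j.
have as' i j : ac (a i) (star (a j)) = (i == j)%:R := as_ i j.
have ii : 'i%C * 'i%C = -1 :> R[i] by rewrite -expr2 sqr_i.
case: k l => [i b] [j b']; rewrite /majorana -pair_eqE /pair_eq /=.
case: b b' => [] [] /=; rewrite ?acZl ?acZr !acDl !acDr ?acNl ?acNr ?ss ?sa ?aa' ?as' //=.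
- rewrite scalerA ii scaleN1r andbT; case: (i == j);
  by rewrite !(oppr0, opprD, opprK, addr0, add0r, subr0).
- rewrite andbF; case: (i == j);
  by rewrite !(oppr0, opprD, opprK, addr0, add0r, subr0, subrr, addNr, scaler0).
- rewrite andbF; case: (i == j);
  by rewrite !(oppr0, opprD, opprK, addr0, add0r, subr0, subrr, addNr, scaler0).
- by rewrite andbT; case: (i == j); rewrite !(addr0, add0r).
Qed.

Lemma majorana_star k : star (majorana k) = majorana k.
Proof.
rewrite /majorana; case: k.2; last by rewrite starD starK addrC.
rewrite starZ starB starK -[in LHS]opprB scalerN -scaleNr; congr (_ *: _).
by apply/eqP; rewrite eq_complex /= oppr0 opprK !eqxx.
Qed.

Lemma majorana_sqr k : majorana k * majorana k = 1.
Proof.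
have := majorana_anticomm k k; rewrite eqxx /ac.
have half (x : T) : x = (2^-1 : R[i]) *: (x + x).
  by rewrite -mulr2n -(scaler_nat 2 x) scalerA mulVf ?scale1r // pnatr_eq0.
by move=> e; rewrite (half (_ * _)) e (half 1).
Qed.

Lemma majorana_anti k l : k != l ->
  majorana k * majorana l = - (majorana l * majorana k).
Proof.
move=> /negbTE kl; apply/eqP; rewrite -addr_eq0; apply/eqP.
by have := majorana_anticomm k l; rewrite kl.
Qed.

Lemma mode_fresh (K : seq (int * bool)) : exists l, l \notin K.
Proof.
pose m := (\sum_(k <- K) `|k.1|%N)%N.
exists (Posz m.+1, true); apply/negP => mK.
have : (m.+1 <= m)%N by rewrite {2}/m (big_rem _ mK) /= leq_addr.
by rewrite ltnn.
Qed.

Lemma clifford_sub (S : set T) (K : seq (int * bool)) : star_subalgebra S ->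
  (forall k, k \in K -> S (majorana k)) -> clifford majorana K `<=` S.
Proof.
move=> Ssub; elim: K => [_ x [z ->]|k K IH SK x [u [v [Ku Kv ->]]]].
  by apply: (subalgebraZ Ssub); exact: subalgebra1.
have {}IH : clifford majorana K `<=` S.
  by apply: IH => j jK; apply: SK; rewrite inE jK orbT.
apply: (subalgebraD Ssub); first exact: IH.
by apply: (subalgebraM Ssub); [apply: SK; exact: mem_head|exact: IH].
Qed.

(** The norm closure in the definition of the generated algebra adds nothing, because [clifford] is
    already closed. *)
Lemma local_algebra_clifford (I : set int) (K : seq (int * bool)) : uniq K ->
  (forall k, k \in K <-> I k.1) -> local_algebra a I = clifford majorana K.
Proof.
move=> uK KI; rewrite eqEsubset; split.
  apply: smallest_sub.
    have [? ? ? ?] := clifford_subalgebra majorana_star majorana_sqr majorana_anti uK.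
    split=> //.
    exact: (clifford_closed majorana_sqr majorana_anti mode_fresh).
  move=> _ [i Ii <-].
  have Kb b : clifford majorana K (majorana (i, b)).
    by apply: clifford_gen; apply/KI.
  have -> : a i = (2^-1 : R[i]) *: majorana (i, false)
      + (- 'i%C / 2 : R[i]) *: majorana (i, true).
    rewrite /majorana /= scalerA mulrAC mulNr -expr2 sqr_i opprK mul1r.
    by rewrite -scalerDr addrACA subrr addr0 half2.
  have := clifford_lin (- 'i%C / 2) (Kb true) (clifford0 majorana K).
  by rewrite addr0; exact: clifford_lin.
move=> x Kx S [[S1 Slin SM Sst _] aS].
have Ssub : star_subalgebra S by [].
apply: (clifford_sub Ssub) Kx => -[i b] /KI /= Ii.
have Sa : S (a i) by apply: aS; exists i.
by rewrite /majorana; case: b => /=; in_subalgebra Ssub.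
Qed.

End CARmodes.

Definition modes (s : seq int) : seq (int * bool) :=
  [seq (i, b) | i <- s, b <- [:: false; true]].

Lemma modes_uniq s : uniq s -> uniq (modes s).
Proof. by move=> us; apply: allpairs_uniq => // -[? ?] [? ?]. Qed.

Lemma mem_modes s k : (k \in modes s) = (k.1 \in s).
Proof.
case: k => i b; apply/allpairsP/idP => [[[j b'] [js _ [-> _]]] //|is_].
exists (i, b); split=> //=; by case: (b).
Qed.

(** * Functional calculus *)

Section FunctionalCalculus.
Context (R : realType) (T : cstarAlgType R).
Implicit Types (x y : T) (S : set T).

Definition calculus n (l : 'I_n -> R) (p : 'I_n -> T) (f : R -> R[i]) : T :=
  \sum_k f (l k) *: p k.

(** Orthogonality of the projections lets a polynomial in [x] act on eigenvalues. Two resolutions of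
    [x] become comparable through one polynomial that interpolates [f] on both spectra; this gives
    uniqueness of the functional calculus. *)
Lemma is_fcalc_horner (f : R -> R[i]) x y : is_fcalc f x y ->
  exists s : seq R, forall P : {poly R[i]},
    (forall r, r \in s -> P.[r%:C%C] = f r) -> y = horner_alg x P.
Proof.
move=> [n [l [p [_ porth psum -> ->]]]].
exists [seq l k | k <- enum 'I_n] => P PE.
under eq_bigr do rewrite -PE ?map_f ?mem_enum //.
elim/poly_ind: P {PE} => [|P c IH].
  by rewrite rmorph0 big1 // => k _; rewrite horner0 scale0r.
rewrite rmorphD rmorphM /= horner_algX horner_algC -IH.
rewrite -[X in _ *: X]psum scaler_sumr mulr_suml -big_split /=.
apply: eq_bigr => k _; rewrite mulr_sumr (bigD1 k) //= big1 => [|j jk].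
  rewrite addr0 -scalerAl -scalerAr porth eqxx scalerA -scalerDl.
  by rewrite hornerD hornerM hornerX hornerC.
by rewrite -scalerAl -scalerAr porth eq_sym (negbTE jk) !scaler0.
Qed.

Lemma is_fcalc_uniq (f : R -> R[i]) x y y' :
  is_fcalc f x y -> is_fcalc f x y' -> y = y'.
Proof.
move=> /is_fcalc_horner[s sP] /is_fcalc_horner[s' sP'].
have [P PE] := interpolation [seq r%:C%C | r <- s ++ s']
  (fun z : R[i] => f (complex.Re z)).
have PE' r : r \in s ++ s' -> P.[r%:C%C] = f r by move=> rs; rewrite PE // map_f.
rewrite (sP P) ?(sP' P) // => r rs; apply: PE'; by rewrite mem_cat rs ?orbT.
Qed.

Section Resolution.
Variables (S : set T) (x : T) (n : nat) (l : 'I_n -> R) (p : 'I_n -> T).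
Hypothesis Ssub : star_subalgebra S.
Hypothesis xlp : spectral_resolution (@star R T) S x l p.

Lemma calculusM f g :
  calculus l p f * calculus l p g = calculus l p (fun r => f r * g r).
Proof.
rewrite /calculus mulr_suml; apply: eq_bigr => k _.
rewrite mulr_sumr (bigD1 k) //= big1 => [|j jk].
  by rewrite addr0 -scalerAl -scalerAr (spectral_orth xlp) eqxx scalerA.
by rewrite -scalerAl -scalerAr (spectral_orth xlp) eq_sym (negbTE jk) !scaler0.
Qed.

Lemma calculus_in f : S (calculus l p f).
Proof.
apply: (subalgebra_sum Ssub) => k _; apply: (subalgebraZ Ssub).
exact: (spectral_in xlp).
Qed.

Lemma calculus_star f :
  star (calculus l p f) = calculus l p (fun r => (f r)^*%C).
Proof.
by rewrite star_sum; apply: eq_bigr => k _; rewrite starZ (spectral_star xlp).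
Qed.

Lemma calculus1 : calculus l p (fun=> 1) = 1.
Proof.
by rewrite -(spectral_sum1 xlp); apply: eq_bigr => k _; rewrite scale1r.
Qed.

Lemma calculus_id : calculus l p (fun r => r%:C%C) = x.
Proof. by rewrite [RHS](spectral_sum xlp). Qed.

Lemma calculus_eq f g : (forall k, f (l k) = g (l k)) ->
  calculus l p f = calculus l p g.
Proof. by move=> fg; apply: eq_bigr => k _; rewrite fg. Qed.

Lemma fcalcE f : fcalc f x = calculus l p f.
Proof.
have h : is_fcalc f x (calculus l p f).
  exists n, l, p; split=> //; [exact: (spectral_star xlp)|exact: (spectral_orth xlp)
  |exact: (spectral_sum1 xlp)|exact: (spectral_sum xlp)].
rewrite /fcalc; case: xgetP => [y _ yP|/(_ _ h) //].
exact: (is_fcalc_uniq yP h).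
Qed.

Lemma spectral_self_adjoint : star x = x.
Proof.
rewrite -calculus_id calculus_star; apply: calculus_eq => k.
by rewrite conjc_real.
Qed.

End Resolution.

Section Sandwich.
Variables (S S' : set T) (x x' : T) (m n : nat).
Variables (q : 'I_m -> R) (f : 'I_m -> T) (p : 'I_n -> R) (e : 'I_n -> T).
Hypothesis xqf : spectral_resolution (@star R T) S x q f.
Hypothesis xpe : spectral_resolution (@star R T) S' x' p e.

(** This is G(L, R) y for the commuting operators L, left multiplication by [x], and R, right
    multiplication by [x']. Functions of s / t are functions of the relative modular operator. *)
Definition sandwich (y : T) (G : R -> R -> R[i]) : T :=
  \sum_(k : 'I_m * 'I_n) G (q k.1) (p k.2) *: (f k.1 * y * e k.2).

Lemma sandwich_eq y G H : (forall j i, G (q j) (p i) = H (q j) (p i)) ->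
  sandwich y G = sandwich y H.
Proof. by move=> GH; apply: eq_bigr => k _; rewrite GH. Qed.

Lemma calculus_sandwich y u v :
  calculus q f u * y * calculus p e v = sandwich y (fun s t => u s * v t).
Proof.
rewrite /calculus /sandwich mulr_suml mulr_suml.
rewrite (eq_bigr (fun k : 'I_m * 'I_n =>
  (u (q k.1) * v (p k.2)) *: (f k.1 * y * e k.2))) // -(pair_bigA _ (fun j i =>
  (u (q j) * v (p i)) *: (f j * y * e i))) /=.
apply: eq_bigr => j _; rewrite mulr_sumr; apply: eq_bigr => i _.
by rewrite -scalerAl -scalerAl -scalerAr scalerA.
Qed.

Lemma sandwichMl y u G : calculus q f u * sandwich y G =
  sandwich y (fun s t => u s * G s t).
Proof.
rewrite /sandwich mulr_sumr; apply: eq_bigr => -[j i] _ /=.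
rewrite /calculus mulr_suml (bigD1 j) //= big1 => [|j' jj'].
  by rewrite addr0 -scalerAl -scalerAr !mulrA (spectral_orth xqf) eqxx scalerA.
rewrite -scalerAl -scalerAr !mulrA (spectral_orth xqf) (negbTE jj').
by rewrite !mul0r !scaler0.
Qed.

Lemma sandwichMr y u G : sandwich y G * calculus p e u =
  sandwich y (fun s t => G s t * u t).
Proof.
rewrite /sandwich mulr_suml; apply: eq_bigr => -[j i] _ /=.
rewrite /calculus mulr_sumr (bigD1 i) //= big1 => [|i' ii'].
  rewrite addr0 -scalerAl -scalerAr -[_ * e i * _]mulrA (spectral_orth xpe) eqxx scalerA.
  by rewrite mulrC.
rewrite -scalerAl -scalerAr -[_ * e i * _]mulrA (spectral_orth xpe) eq_sym (negbTE ii').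
by rewrite !mulr0 !scaler0.
Qed.

Lemma sandwichD y G H :
  sandwich y (fun s t => G s t + H s t) = sandwich y G + sandwich y H.
Proof. by rewrite /sandwich -big_split /=; apply: eq_bigr => k _; rewrite scalerDl. Qed.

Lemma sandwichZ y c G : sandwich y (fun s t => c * G s t) = c *: sandwich y G.
Proof. by rewrite /sandwich scaler_sumr; apply: eq_bigr => k _; rewrite scalerA. Qed.

Lemma sandwich_in (U : set T) y G : star_subalgebra U ->
  (forall j, U (f j)) -> (forall i, U (e i)) -> U y -> U (sandwich y G).
Proof. by move=> Usub Uf Ue Uy; in_subalgebra Usub. Qed.

Lemma sandwich_left y u : sandwich y (fun s _ => u s) = calculus q f u * y.
Proof.
rewrite -[RHS]mulr1 -(calculus1 xpe) calculus_sandwich.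
by apply: sandwich_eq => j i; rewrite mulr1.
Qed.

Lemma sandwich_right y u : sandwich y (fun _ t => u t) = y * calculus p e u.
Proof.
rewrite -[y in RHS]mul1r -(calculus1 xqf) calculus_sandwich.
by apply: sandwich_eq => j i; rewrite mul1r.
Qed.

End Sandwich.

End FunctionalCalculus.

(** * Relative entropy *)

Definition root_of {R : realType} (r : R) : R[i] := (Num.sqrt r)%:C%C.
Definition inv_root_of {R : realType} (r : R) : R[i] := (Num.sqrt r)^-1%:C%C.

Section TraceTheory.
Context (R : realType) (T : cstarAlgType R) (tau : T -> R[i]).
Hypothesis tau_tracial : tracial_state tau.
Implicit Types (x y : T) (S : set T).

Let tlin : linear_on (V := R[i]^o) setT tau.
Proof. by case: tau_tracial => -[]. Qed.

Lemma traceD x y : tau (x + y) = tau x + tau y.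
Proof. exact: (linear_onD tlin). Qed.

Lemma traceZ c x : tau (c *: x) = c * tau x.
Proof. exact: (linear_onZ (star_subalgebraT T) tlin). Qed.

Lemma traceB x y : tau (x - y) = tau x - tau y.
Proof. exact: (linear_onB (star_subalgebraT T) tlin). Qed.

Lemma trace0 : tau 0 = 0.
Proof. exact: (linear_on0 (star_subalgebraT T) tlin). Qed.

Lemma trace_sum (I : Type) (r : seq I) (P : pred I) (F : I -> T) :
  tau (\sum_(i <- r | P i) F i) = \sum_(i <- r | P i) tau (F i).
Proof. by apply: (big_morph _ traceD trace0). Qed.

Lemma traceC x y : tau (x * y) = tau (y * x).
Proof. by case: tau_tracial => _; exact. Qed.

Lemma trace_star x : tau (star x) = (tau x)^*%C.
Proof. exact: (state_on_star (star_subalgebraT T) tau_tracial.1). Qed.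

Lemma trace_ge0 x : 0 <= tau (star x * x).
Proof. by case: tau_tracial => -[_ + _] _; exact. Qed.

Section Positive.
Variables (S : set T) (x : T) (n : nat) (l : 'I_n -> R) (p : 'I_n -> T).
Hypothesis Ssub : star_subalgebra S.
Hypothesis xlp : spectral_resolution (@star R T) S x l p.
Hypothesis l_gt0 : forall k, 0 < l k.

Lemma root_ofM k : root_of (l k) * root_of (l k) = (l k)%:C%C.
Proof.
by rewrite -(rmorphM (real_complex R)) -expr2 sqr_sqrtr // ltW.
Qed.

Lemma root_ofV k : root_of (l k) * inv_root_of (l k) = 1.
Proof.
rewrite -(rmorphM (real_complex R)) divff ?rmorph1 //.
by rewrite gt_eqF // sqrtr_gt0.
Qed.

Lemma calculus_root_sqr : calculus l p root_of * calculus l p root_of = x.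
Proof.
rewrite (calculusM xlp) -(calculus_id xlp); apply: calculus_eq => k.
exact: root_ofM.
Qed.

Lemma calculus_rootV : calculus l p root_of * calculus l p inv_root_of = 1.
Proof.
rewrite (calculusM xlp) -(calculus1 xlp); apply: calculus_eq => k.
exact: root_ofV.
Qed.

Lemma calculus_Vroot : calculus l p inv_root_of * calculus l p root_of = 1.
Proof.
rewrite (calculusM xlp) -(calculus1 xlp); apply: calculus_eq => k.
by rewrite mulrC; exact: root_ofV.
Qed.

Lemma calculus_root_star : star (calculus l p root_of) = calculus l p root_of.
Proof.
by rewrite (calculus_star xlp); apply: calculus_eq => k; rewrite conjc_real.
Qed.

Lemma calculus_Vroot_star :
  star (calculus l p inv_root_of) = calculus l p inv_root_of.
Proof.
by rewrite (calculus_star xlp); apply: calculus_eq => k; rewrite conjc_real.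
Qed.

Lemma weighted_trace y : tau (x * (star y * y)) =
  tau (star (y * calculus l p root_of) * (y * calculus l p root_of)).
Proof.
by rewrite starM calculus_root_star -calculus_root_sqr -mulrA traceC !mulrA.
Qed.

Lemma weighted_trace_ge0 y : 0 <= tau (x * (star y * y)).
Proof. by rewrite weighted_trace trace_ge0. Qed.

Lemma weighted_trace_eq0 y :
  (forall z, S z -> tau (star z * z) = 0 -> z = 0) ->
  S y -> tau (x * (star y * y)) = 0 -> y = 0.
Proof.
move=> Sfaith Sy; rewrite weighted_trace => /Sfaith y0.
rewrite -[y]mulr1 -calculus_rootV mulrA y0 ?mul0r //.
by apply: (subalgebraM Ssub) => //; exact: (calculus_in Ssub xlp).
Qed.

End Positive.
End TraceTheory.

Lemma conjc_comb_real (R : realType) (z w : R[i]) (s : R) :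
  (z + s%:C%C * w)^*%C = z^*%C + s%:C%C * w^*%C.
Proof. by case: z w => [x y] [u v] /=; congr Complex; ring. Qed.

Lemma conjcB (R : realType) (z w : R[i]) : (z - w)^*%C = z^*%C - w^*%C.
Proof. by case: z w => [x y] [u v] /=; congr Complex; ring. Qed.

Section RelativeEntropy.
Context (R : realType) (T : cstarAlgType R) (tau : T -> R[i]).
Hypothesis tau_tracial : tracial_state tau.
Local Notation toC := (@real_complex_def R (Phant R)).

Variables (M N : set T).
Hypotheses (Msub : star_subalgebra M) (Nsub : star_subalgebra N).
Hypothesis NM : N `<=` M.
Hypothesis M_faithful : forall y, M y -> tau (star y * y) = 0 -> y = 0.

Variables (rho sigma rhoN sigmaN : T) (n m n' m' : nat).
Variables (p : 'I_n -> R) (e : 'I_n -> T) (q : 'I_m -> R) (f : 'I_m -> T).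
Variables (p' : 'I_n' -> R) (e' : 'I_n' -> T) (q' : 'I_m' -> R) (f' : 'I_m' -> T).
Hypothesis rhoE : spectral_resolution (@star R T) M rho p e.
Hypothesis sigmaE : spectral_resolution (@star R T) M sigma q f.
Hypothesis rhoNE : spectral_resolution (@star R T) N rhoN p' e'.
Hypothesis sigmaNE : spectral_resolution (@star R T) N sigmaN q' f'.
Hypotheses (p_gt0 : forall i, 0 < p i) (q_gt0 : forall j, 0 < q j).
Hypotheses (p'_gt0 : forall i, 0 < p' i) (q'_gt0 : forall j, 0 < q' j).
Hypothesis rhoN_rho : forall y, N y -> tau (rhoN * y) = tau (rho * y).
Hypothesis sigmaN_sigma : forall y, N y -> tau (sigmaN * y) = tau (sigma * y).

(* g(Delta) applied to the identity, where Delta y = sigma y rho^-1 is the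
   relative modular operator. *)
Definition modular (g : R -> R[i]) : T :=
  sandwich q f p e 1 (fun s t => g (s / t)).

Definition modularN (g : R -> R[i]) : T :=
  sandwich q' f' p' e' 1 (fun s t => g (s / t)).

Definition defect (g : R -> R[i]) : T := modular g - modularN g.

Definition resolvent (s : R) : R -> R[i] := fun t => toC (s + t)^-1.

(** For the inner product tau(rho * (star z * y)), this is the sesquilinear form of Delta + s, with
    the inverse of [rho] cancelled. On [N] it sees only the restrictions of tau(rho .) and tau(sigma
    .), so there it is the form of Delta_N + s. *)
Let form s y z : R[i] := tau (sigma * (y * star z)) + toC s * tau (rho * (star z * y)).

Let formB s y y' z : form s (y - y') z = form s y z - form s y' z.
Proof.
rewrite /form mulrBl [star z * _]mulrBr !mulrBr !(traceB tau_tracial) mulrBr.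
by rewrite opprD addrACA.
Qed.

Let form_conj s y z : form s z y = (form s y z)^*%C.
Proof.
have -> : (form s y z)^*%C = (tau (sigma * (y * star z)))^*%C
    + toC s * (tau (rho * (star z * y)))^*%C.
  exact: conjc_comb_real.
rewrite /form -!(trace_star tau_tracial).
rewrite !starM !starK (spectral_self_adjoint rhoE) (spectral_self_adjoint sigmaE).
by congr (_ + _ * _); rewrite (traceC tau_tracial).
Qed.

Let form_ge0 s y : 0 < s -> 0 <= form s y y.
Proof.
move=> s0; apply: addr_ge0.
  by rewrite -{1}(starK y) (weighted_trace_ge0 tau_tracial sigmaE).
by rewrite mulr_ge0 ?(weighted_trace_ge0 tau_tracial rhoE) // ler0c ltW.
Qed.

Let form_eq0 s y : 0 < s -> M y -> form s y y = 0 -> y = 0.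
Proof.
move=> s0 My /eqP; rewrite paddr_eq0.
- move=> /andP[_]; rewrite mulf_eq0 => /orP[/eqP/complexI s00|/eqP].
    by rewrite s00 ltxx in s0.
  exact: (weighted_trace_eq0 tau_tracial Msub rhoE).
- by rewrite -{1}(starK y) (weighted_trace_ge0 tau_tracial sigmaE).
- by rewrite mulr_ge0 ?(weighted_trace_ge0 tau_tracial rhoE) // ler0c ltW.
Qed.

(* Sylvester's equation: (Delta + s) applied to the resolvent gives 1. *)
Let sylvester S S' x x' k k' (a : 'I_k -> R) (u : 'I_k -> T) (b : 'I_k' -> R)
    (v : 'I_k' -> T) s : 0 < s ->
  spectral_resolution (@star R T) S x a u ->
  spectral_resolution (@star R T) S' x' b v ->
  (forall j, 0 < a j) -> (forall j, 0 < b j) ->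
  let X := sandwich a u b v 1 (fun r t => resolvent s (r / t)) in
  star X * x + toC s *: (x' * star X) = x'.
Proof.
move=> s0 xau xbv a0 b0 X.
suff XE : x * X + toC s *: (X * x') = x'.
  have := congr1 (@star R T) XE; rewrite starD starZ !starM conjc_real.
  by rewrite (spectral_self_adjoint xau) (spectral_self_adjoint xbv).
rewrite -{1}(calculus_id xau) -[x' in LHS](calculus_id xbv) /X.
rewrite (sandwichMl _ _ xau) (sandwichMr _ _ xbv) -sandwichZ -sandwichD.
rewrite -[RHS](calculus_id xbv) -[RHS]mul1r -(sandwich_right _ _ xau).
apply: sandwich_eq => j i; rewrite /resolvent.
rewrite -!(rmorphM (real_complex R)) -(rmorphD (real_complex R)); congr (toC _).
have bi0 : b i != 0 by rewrite gt_eqF.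
have d0 : s * b i + a j != 0 by rewrite gt_eqF // addr_gt0 // mulr_gt0.
by field; rewrite bi0 d0.
Qed.

Let modular_in g : M (modular g).
Proof.
apply: (@sandwich_in _ _ _ _ _ _ _ _ M) => //;
  [exact: (spectral_in sigmaE)|exact: (spectral_in rhoE)|].
exact: subalgebra1.
Qed.

Let modularN_in g : N (modularN g).
Proof.
apply: (@sandwich_in _ _ _ _ _ _ _ _ N) => //;
  [exact: (spectral_in sigmaNE)|exact: (spectral_in rhoNE)|].
exact: subalgebra1.
Qed.

Let form_modular s y : 0 < s -> form s y (modular (resolvent s)) = tau (rho * y).
Proof.
move=> s0; rewrite -{1}(sylvester s0 sigmaE rhoE q_gt0 p_gt0) -/(modular _).
rewrite /form mulrDl (traceD tau_tracial) -scalerAl (traceZ tau_tracial).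
congr (_ + _ * tau _); last by rewrite mulrA.
by rewrite -[in RHS]mulrA [RHS](traceC tau_tracial) mulrA.
Qed.

Let form_modularN s y : 0 < s -> N y ->
  form s y (modularN (resolvent s)) = tau (rho * y).
Proof.
move=> s0 Ny; rewrite -rhoN_rho //.
rewrite -{1}(sylvester s0 sigmaNE rhoNE q'_gt0 p'_gt0) -/(modularN _).
have NX := modularN_in (resolvent s).
rewrite /form -sigmaN_sigma -?rhoN_rho; try in_subalgebra Nsub.
rewrite mulrDl (traceD tau_tracial) -scalerAl (traceZ tau_tracial).
congr (_ + _ * tau _); last by rewrite mulrA.
by rewrite -[in RHS]mulrA [RHS](traceC tau_tracial) mulrA.
Qed.

(** Pythagoras: the two resolvents X and X' represent tau(rho .) for the form on [M] and on [N], so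
    X' is the orthogonal projection of X to [N], and form V V is form X X - form X' X'. *)
Lemma trace_defect s : 0 < s ->
  let V := defect (resolvent s) in tau (rho * V) = form s V V.
Proof.
move=> s0 V; rewrite {1}/V /defect mulrBr (traceB tau_tracial).
set X := modular _; set X' := modularN _.
have NX' : N X' by exact: modularN_in.
have XX : form s X X = tau (rho * X) by exact: form_modular.
have XX' : form s X' X = tau (rho * X') by exact: form_modular.
have X'X' : form s X' X' = tau (rho * X') by exact: form_modularN.
have real : (tau (rho * X'))^*%C = tau (rho * X') by rewrite -X'X' -form_conj.
rewrite -[V]/(X - X') formB [form s X _]form_conj [form s X' _]form_conj !formB.
rewrite XX XX' X'X' !conjcB -form_conj XX' real.
by rewrite -{2}XX -form_conj XX subrr subr0.
Qed.

Lemma trace_defect_ge0 s : 0 < s -> 0 <= tau (rho * defect (resolvent s)).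
Proof. by move=> s0; rewrite trace_defect //; exact: form_ge0. Qed.

(* The variational principle: X = modular (resolvent s) maximizes
   2 Re phi(Y) - form s Y Y over M, and modularN (resolvent s) does so over N. *)
Lemma trace_defect_le0 (E : T -> T) s : 0 < s ->
  (forall y, M y -> [/\ N (E y), tau (rho * E y) = tau (rho * y),
     tau (sigma * (E y * star (E y))) <= tau (sigma * (y * star y))
   & tau (rho * (star (E y) * E y)) <= tau (rho * (star y * y))]) ->
  tau (rho * defect (resolvent s)) <= 0.
Proof.
move=> s0 EP; rewrite /defect mulrBr (traceB tau_tracial).
set X := modular _; set X' := modularN _.
have [NEX phiEX psi_le phi_le] := EP X (modular_in _).
have XX : form s X X = tau (rho * X) by exact: form_modular.
have NX' : N X' by exact: modularN_in.
have X'X' : form s X' X' = tau (rho * X') by exact: form_modularN.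
have EXX' : form s (E X) X' = tau (rho * X) by rewrite form_modularN.
have real : (tau (rho * X))^*%C = tau (rho * X) by rewrite -XX -form_conj.
have EXle : form s (E X) (E X) <= tau (rho * X).
  rewrite -XX lerD // ler_wpM2l // ler0c; exact: ltW.
(* Expand the square: both cross terms are tau(rho * X), because X' represents tau(rho .) on [N] and
   [E] preserves it. With [EXle], this leaves 0 <= tau(rho * X') - tau(rho * X). *)
have : 0 <= form s (E X - X') (E X - X') by exact: form_ge0.
rewrite formB [form s (E X) _]form_conj [form s X' _]form_conj !formB.
rewrite [form s X' (E X)]form_conj EXX' real X'X'.
have real' : (tau (rho * X'))^*%C = tau (rho * X') by rewrite -X'X' -form_conj.
rewrite !conjcB -form_conj real real' => h.
rewrite subr_le0 -subr_ge0; apply: le_trans h _.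
by rewrite opprB gerDr subr_le0.
Qed.

(** The spectra of Delta and Delta_N are put on one index set, the second with a minus sign, so that
    [defect] integrates [g] against a finite vector measure; the scalar lemmas on resolvents and
    logarithms then apply. *)
Lemma defect_family : exists (I : finType) (t : I -> R) (v : I -> T),
  [/\ forall i, 0 < t i, forall g, defect g = \sum_i g (t i) *: v i,
      forall i, M (v i) & forall i, (tau (rho * v i))^*%C = tau (rho * v i)].
Proof.
pose I := ('I_m * 'I_n + 'I_m' * 'I_n')%type.
exists I, (fun i : I => match i with
  | inl k => q k.1 / p k.2 | inr k => q' k.1 / p' k.2 end),
  (fun i : I => match i with
  | inl k => f k.1 * 1 * e k.2 | inr k => - (f' k.1 * 1 * e' k.2) end).
(* An eigenprojection absorbs [x] as its eigenvalue, and the trace of a product of two self-adjoint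
   elements is real by cyclicity. *)
have pair_real S S' x y k k' (b : 'I_k -> R) (u : 'I_k -> T) (d : 'I_k' -> R)
    (w : 'I_k' -> T) j i : spectral_resolution (@star R T) S x b u ->
    spectral_resolution (@star R T) S' y d w ->
    (tau (x * (w j * 1 * u i)))^*%C = tau (x * (w j * 1 * u i)).
  move=> xbu ydw.
  have ux : u i * x = toC (b i) *: u i.
    rewrite {1}(spectral_sum xbu) mulr_sumr (bigD1 i) //= big1 => [|h hi].
      by rewrite addr0 -scalerAr (spectral_orth xbu) eqxx.
    by rewrite -scalerAr (spectral_orth xbu) eq_sym (negbTE hi) scaler0.
  rewrite mulr1 (traceC tau_tracial) -mulrA ux -scalerAr (traceZ tau_tracial).
  set z := tau _; have zr : z^*%C = z.
    by rewrite -(trace_star tau_tracial) starM (spectral_star xbu)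
      (spectral_star ydw) (traceC tau_tracial).
  by have := conjc_comb_real 0 z (b i); rewrite !add0r conjc0 add0r zr.
split.
- by case=> k; rewrite divr_gt0.
- move=> g; rewrite big_sumType /= /defect /modular /modularN /sandwich.
  by congr (_ + _); rewrite -sumrN; apply: eq_bigr => k _; rewrite scalerN.
- have M1 := subalgebra1 Msub.
  case=> k.
    have Mf := spectral_in sigmaE k.1; have Me := spectral_in rhoE k.2.
    by in_subalgebra Msub.
  have Mf := NM (spectral_in sigmaNE k.1); have Me := NM (spectral_in rhoNE k.2).
  by in_subalgebra Msub.
- case=> k; first exact: pair_real rhoE sigmaE.
  rewrite mulrN -scaleN1r (traceZ tau_tracial) mulN1r -rhoN_rho.
    rewrite -[- _]sub0r conjcB conjc0; congr (_ - _).
    exact: pair_real rhoNE sigmaNE.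
  have N1 := subalgebra1 Nsub.
  have Nf := spectral_in sigmaNE k.1; have Ne := spectral_in rhoNE k.2.
  by in_subalgebra Nsub.
Qed.

(** For resolvents the trace is a definite square, so the defect itself vanishes;
    [resolvents_determine], applied to the scalars tau(star (defect g) * v i), extends this to every
    [g]. *)
Lemma defect_eq0 : (forall s, 0 < s -> tau (rho * defect (resolvent s)) = 0) ->
  forall g, defect g = 0.
Proof.
move=> h g; have [I [t [v [t0 defE Mv _]]]] := defect_family.
have MV g' : M (defect g').
  by rewrite defE; in_subalgebra Msub.
have res0 s : 0 < s -> defect (resolvent s) = 0.
  by move=> s0; apply: (form_eq0 s0 (MV _)); rewrite -trace_defect ?h.
apply: M_faithful => //.
rewrite [X in star _ * X]defE mulr_sumr (trace_sum tau_tracial).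
rewrite (eq_bigr (fun i => g (t i) * tau (star (defect g) * v i))); last first.
  by move=> i _; rewrite -scalerAr (traceZ tau_tracial).
apply: resolvents_determine t0 _ _ => [i j -> //|s s0].
rewrite -[RHS](trace0 tau_tracial) -(mulr0 (star (defect g))) -(res0 s s0).
rewrite [X in star _ * X]defE mulr_sumr (trace_sum tau_tracial); apply: eq_bigr => i _.
by rewrite -scalerAr (traceZ tau_tracial).
Qed.

(** The weights tau(rho * v i) have total mass 0, as g = 1 gives the identity on both sides, and
    nonnegative resolvent sums by [trace_defect_ge0]; so [log_moment_eq0] applies. *)
Lemma defect_log_eq0 : tau (rho * defect (fun t => toC (ln t))) = 0 ->
  forall s, 0 < s -> tau (rho * defect (resolvent s)) = 0.
Proof.
move=> h; have [I [t [v [t0 defE Mv vreal]]]] := defect_family.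
pose w i := complex.Re (tau (rho * v i)).
have wE i : tau (rho * v i) = toC (w i).
  by have := ReJ_add (tau (rho * v i)); rewrite vreal -mulr2n
    -(mulr_natr (tau _)) mulfK ?pnatr_eq0.
have traceE (g : R -> R) :
    tau (rho * defect (fun r => toC (g r))) = toC (\sum_i g (t i) * w i).
  rewrite defE mulr_sumr (trace_sum tau_tracial) (raddf_sum (real_complex R)).
  apply: eq_bigr => i _; rewrite -scalerAr (traceZ tau_tracial) wE.
  by rewrite [RHS](rmorphM (real_complex R)).
have w0 : \sum_i w i = 0.
  apply: complexI; have := traceE (fun=> 1).
  under [in RHS]eq_bigr do rewrite mul1r; move=> <-.
  rewrite /defect /modular /modularN.
  have one S S' x x' k k' (a : 'I_k -> R) (u : 'I_k -> T) (b : 'I_k' -> R)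
      (z : 'I_k' -> T) : spectral_resolution (@star R T) S x a u ->
      spectral_resolution (@star R T) S' x' b z ->
      sandwich a u b z 1 (fun _ _ => toC 1) = 1.
    move=> xau xbz; rewrite (sandwich_left _ _ xbz 1 (fun=> toC 1)).
    by rewrite -(calculus1 xau) (calculusM xau); apply: calculus_eq => j; rewrite mulr1.
  by rewrite (one _ _ _ _ _ _ _ _ _ _ sigmaE rhoE) (one _ _ _ _ _ _ _ _ _ _ sigmaNE rhoNE)
    subrr mulr0 (trace0 tau_tracial).
move=> s s0; rewrite traceE (log_moment_eq0 t0 w0) //.
  move=> r r0; have := trace_defect_ge0 r0.
  by rewrite traceE ler0c.
by apply: complexI; rewrite -traceE.
Qed.

Lemma defect_logE : defect (fun t => toC (ln t)) =
  calculus q f (fun t => toC (ln t)) - calculus p e (fun t => toC (ln t))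
  - (calculus q' f' (fun t => toC (ln t)) - calculus p' e' (fun t => toC (ln t))).
Proof.
have logE S S' x x' k k' (a : 'I_k -> R) (u : 'I_k -> T) (b : 'I_k' -> R)
    (z : 'I_k' -> T) : spectral_resolution (@star R T) S x a u ->
    spectral_resolution (@star R T) S' x' b z ->
    (forall i, 0 < a i) -> (forall i, 0 < b i) ->
    sandwich a u b z 1 (fun r t => toC (ln (r / t)))
    = calculus a u (fun t => toC (ln t)) - calculus b z (fun t => toC (ln t)).
  move=> xau xbz a0 b0.
  rewrite -[X in X - _]mulr1 -(sandwich_left _ _ xbz).
  rewrite -[X in _ - X]mul1r -(sandwich_right _ _ xau) -scaleN1r.
  rewrite -sandwichZ -sandwichD; apply: sandwich_eq => j i.
  rewrite ln_div ?posrE // mulN1r.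
  by rewrite (raddfB (real_complex R)).
by rewrite /defect /modular /modularN (logE _ _ _ _ _ _ _ _ _ _ sigmaE rhoE)
  // (logE _ _ _ _ _ _ _ _ _ _ sigmaNE rhoNE).
Qed.

(** For g the square root, g(Delta) 1 is sigma^(1/2) rho^(-1/2). This is the only g that the
    recovery map calls for. *)
Lemma defect_root : defect root_of = 0 ->
  calculus q f root_of * calculus p e inv_root_of =
  calculus q' f' root_of * calculus p' e' inv_root_of.
Proof.
have rootE S S' x x' k k' (a : 'I_k -> R) (u : 'I_k -> T) (b : 'I_k' -> R)
    (z : 'I_k' -> T) : spectral_resolution (@star R T) S x a u ->
    spectral_resolution (@star R T) S' x' b z ->
    (forall i, 0 < a i) -> (forall i, 0 < b i) ->
    sandwich a u b z 1 (fun r t => root_of (r / t))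
    = calculus a u root_of * calculus b z inv_root_of.
  move=> xau xbz a0 b0; rewrite -[X in X * _]mulr1 calculus_sandwich.
  apply: sandwich_eq => j i; rewrite /root_of /inv_root_of.
  rewrite sqrtrM ?sqrtrV ?ltW //.
  by rewrite (rmorphM (real_complex R)).
move=> /eqP; rewrite subr_eq0 => /eqP.
by rewrite /modular /modularN (rootE _ _ _ _ _ _ _ _ _ _ sigmaE rhoE)
  // (rootE _ _ _ _ _ _ _ _ _ _ sigmaNE rhoNE).
Qed.

End RelativeEntropy.

(** * Completely positive maps preserving a state *)

Section Schwarz.
Context (R : realType) (T : cstarAlgType R) (M N : set T) (E : T -> T).
Hypotheses (Msub : star_subalgebra M) (Nsub : star_subalgebra N).
Hypothesis Ecp : completely_positive M N E.
Hypothesis E1 : E 1 = 1.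

Let E_in x : M x -> N (E x). Proof. by case: Ecp => _ + _; exact. Qed.

(** The matrix of all [star (w i) * w j] is the square of the matrix with first row [w] and zeros
    elsewhere; complete positivity factors its image. *)
Lemma cp_gram n (w : 'I_n.+1 -> T) : (forall i, M (w i)) ->
  exists2 Z : 'M[T]_n.+1, forall i j, N (Z i j) &
    forall i j, E (star (w i) * w j) = \sum_k star (Z k i) * Z k j.
Proof.
move=> Mw; have [_ _ /(_ n.+1)Epos] := Ecp.
pose Y : 'M[T]_n.+1 := \matrix_(i, j) if i == 0 then w j else 0.
have [|Z [NZ EZ]] := Epos ((map_mx (@star R T) Y)^T *m Y).
  exists Y; split=> // i j; rewrite mxE; case: ifP => // _.
  exact: subalgebra0.
exists Z => // i j; have := congr1 (fun X : 'M[T]_n.+1 => X i j) EZ.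
rewrite !mxE (bigD1 0) //= !mxE /= big1 ?addr0 => [->|k k0].
  by apply: eq_bigr => k _; rewrite !mxE.
by rewrite !mxE (negbTE k0) mulr0.
Qed.

(* Kadison-Schwarz with an explicit remainder; the mixed term yields the
   multiplicative domain. *)
Lemma cp_schwarz y z : M y -> M z -> exists n (d d' : 'I_n -> T),
  [/\ forall k, N (d k), forall k, N (d' k),
   E (star y * y) = star (E y) * E y + \sum_k star (d k) * d k,
   E (star z * z) = star (E z) * E z + \sum_k star (d' k) * d' k
  & E (star y * z) = star (E y) * E z + \sum_k star (d k) * d' k].
Proof.
move=> My Mz; pose w (i : 'I_3) := nth 1 [:: 1; y; z] i.
have M1 := subalgebra1 Msub.
have Mw i : M (w i) by case: i => -[|[|[|]]].
have [Z NZ EZ] := cp_gram Mw.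
(* Gram-Schmidt: column 0, which belongs to w_0 = 1, has square norm E(1) = 1, and [d i] is what
   remains of column i after removing its component E(w_i) along column 0. *)
pose d i k := Z k i - Z k 0 * E (w i).
have EwE i : E (w i) = \sum_k star (Z k 0) * Z k i.
  by rewrite -EZ star1 mul1r.
have EwsE i : star (E (w i)) = \sum_k star (Z k i) * Z k 0.
  by rewrite EwE star_sum; apply: eq_bigr => k _; rewrite starM starK.
have Z1 : \sum_k star (Z k 0) * Z k 0 = 1 by rewrite -EwE E1.
have dd i j : \sum_k star (d i k) * d j k
    = E (star (w i) * w j) - star (E (w i)) * E (w j).
  rewrite EZ; transitivity (\sum_k (star (Z k i) * Z k j
      - star (Z k i) * Z k 0 * E (w j)
      - star (E (w i)) * (star (Z k 0) * Z k j)
      + star (E (w i)) * (star (Z k 0) * Z k 0) * E (w j))).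
    apply: eq_bigr => k _; rewrite /d starB starM mulrBl !mulrBr !mulrA.
    by rewrite opprB addrA addrAC.
  rewrite big_split !sumrB /= -!mulr_suml -!mulr_sumr -EwsE Z1 mulr1 -EwE.
  by rewrite addrNK.
exists 3%N, (d 1), (d (inord 2)); split.
- move=> k; have NE := E_in (Mw 1); have NZ1 := NZ k 1; have NZ0 := NZ k 0.
  by in_subalgebra Nsub.
- move=> k; have NE := E_in (Mw (inord 2)); have NZ1 := NZ k (inord 2); have NZ0 := NZ k 0.
  by in_subalgebra Nsub.
- by rewrite dd addrC subrK.
- by rewrite dd /w inordK //= addrC subrK.
- by rewrite dd /w inordK //= addrC subrK.
Qed.

Lemma cp_star y : M y -> E (star y) = star (E y).
Proof.
move=> My; pose w (i : 'I_2) := nth 1 [:: 1; y] i.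
have M1 := subalgebra1 Msub.
have Mw i : M (w i) by case: i => -[|[|]].
have [Z NZ EZ] := cp_gram Mw.
have := EZ 1 0; rewrite /w /= mulr1 => ->.
have := EZ 0 1; rewrite /w /= star1 mul1r => ->.
by rewrite star_sum; apply: eq_bigr => k _; rewrite starM starK.
Qed.

End Schwarz.

(** * Imaginary and integer powers of the modular automorphism *)

Definition cis {R : realType} (x : R) : R[i] := (cos x +i* sin x)%C.

Lemma cisD (R : realType) (x y : R) : cis (x + y) = cis x * cis y.
Proof. by rewrite /cis cosD sinD; congr Complex; rewrite addrC. Qed.

Lemma cis_nat (R : realType) (x : R) n : cis (x *+ n) = cis x ^+ n.
Proof.
elim: n => [|n IH]; first by rewrite mulr0n expr0 /cis cos0 sin0.
by rewrite mulrS cisD IH exprS.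
Qed.

Lemma ipow_sandwich (R : realType) (T : cstarAlgType R) (S : set T) (x : T) m
    (q : 'I_m -> R) (f : 'I_m -> T) (t : R) (y : T) :
  spectral_resolution (@star R T) S x q f -> (forall j, 0 < q j) ->
  ipow x t * y * ipow x (- t)
  = sandwich q f q f y (fun r s => cis (t * ln (r / s))).
Proof.
move=> xqf q0; rewrite /ipow !(fcalcE xqf) calculus_sandwich.
apply: sandwich_eq => j i; rewrite ln_div ?posrE // mulrBr cisD mulNr.
by congr (_ * _); rewrite /cis mulNr.
Qed.

(** With z_n = x^n y x^(-n), this is the recursion x z_n = z_(n+1) x. Free of inverses, it can be
    pushed through a conditional expectation. *)
Lemma sandwich_ratio_exp (R : realType) (T : cstarAlgType R) (S : set T) (x y : T)
    m (q : 'I_m -> R) (f : 'I_m -> T) n :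
  spectral_resolution (@star R T) S x q f -> (forall j, 0 < q j) ->
  x * sandwich q f q f y (fun r s => (r / s)%:C%C ^+ n) =
  sandwich q f q f y (fun r s => (r / s)%:C%C ^+ n.+1) * x.
Proof.
move=> xqf q0; rewrite -{1}(calculus_id xqf) -[in RHS](calculus_id xqf).
rewrite (sandwichMl _ _ xqf) (sandwichMr _ _ xqf).
apply: sandwich_eq => j i; rewrite -!(rmorphXn (real_complex R)) /=.
rewrite -!(rmorphM (real_complex R)) exprSr -mulrA divfK ?gt_eqF //.
by rewrite mulrC.
Qed.

Lemma spectral_resolution_sub (R : realType) (B : algType R[i]) (st : B -> B)
    (S S' : set B) (x : B) n (l : 'I_n -> R) (p : 'I_n -> B) : S `<=` S' ->
  spectral_resolution st S x l p -> spectral_resolution st S' x l p.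
Proof. by move=> SS' []; split=> // k; apply: SS'. Qed.

(** * Consequences of a Markov map: contraction and invariance under the flow *)

Section Forward.
Context (R : realType) (T : cstarAlgType R) (tau : T -> R[i]).
Hypothesis tau_tracial : tracial_state tau.
Variables (M N P A : set T) (rho sigma : T) (E : T -> T).
Hypotheses (Msub : star_subalgebra M) (Nsub : star_subalgebra N).
Hypothesis (Psub : star_subalgebra P).
Hypotheses (NM : N `<=` M) (PM : P `<=` M) (AN : A `<=` N).
Hypothesis M_faithful : forall y, M y -> tau (star y * y) = 0 -> y = 0.
Hypothesis M_ind : forall Pr : T -> Prop,
  (forall x y, A x -> P y -> Pr (x * y)) ->
  (forall x y, Pr x -> Pr y -> Pr (x + y)) -> forall z, M z -> Pr z.
Hypothesis tau_prod : forall x y, A x -> P y -> tau (x * y) = tau x * tau y.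
Variables (n m : nat).
Variables (p : 'I_n -> R) (e : 'I_n -> T) (q : 'I_m -> R) (f : 'I_m -> T).
Hypothesis rhoE : spectral_resolution (@star R T) M rho p e.
Hypothesis sigmaE : spectral_resolution (@star R T) P sigma q f.
Hypotheses (p_gt0 : forall i, 0 < p i) (q_gt0 : forall j, 0 < q j).
Hypothesis sigma_rho : forall y, P y -> tau (sigma * y) = tau (rho * y).
Hypothesis Ecp : completely_positive M N E.
Hypothesis E1 : E 1 = 1.
Hypothesis E_mod : forall x y, A x -> M y -> E (x * y) = x * E y.
Hypothesis E_rho : forall y, M y -> tau (rho * E y) = tau (rho * y).
Hypothesis E_P : forall y, P y -> P (E y).

Let Elin : linear_on (V := T) M E. Proof. by case: Ecp. Qed.
Let EN y : M y -> N (E y). Proof. by case: Ecp => _ + _; exact. Qed.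
Let EM y : M y -> M (E y). Proof. by move=> /EN/NM. Qed.
Let AM x : A x -> M x. Proof. by move=> /AN/NM. Qed.
Let Psigma : P sigma.
Proof. by rewrite -(calculus_id sigmaE); exact: (calculus_in Psub sigmaE). Qed.
Let Msigma : M sigma := PM Psigma.

Let ED x y : M x -> M y -> E (x + y) = E x + E y.
Proof. by move=> Mx My; rewrite -{1}(scale1r x) Elin // scale1r. Qed.

Let E_sigma y : M y -> tau (sigma * E y) = tau (sigma * y).
Proof.
move=> My; suff [] : M y /\ tau (sigma * E y) = tau (sigma * y) by [].
elim/M_ind: y / My => [x y Ax Py|x y [Mx Ex] [My Ey]]; last first.
  split; first by in_subalgebra Msub.
  by rewrite ED // !mulrDr !(traceD tau_tracial) Ex Ey.
have Mx := AM Ax; have My := PM Py; have PEy := E_P Py.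
split; first by in_subalgebra Msub.
rewrite E_mod // (traceC tau_tracial) [RHS](traceC tau_tracial) -!mulrA.
have prod z : P z -> tau (x * (z * sigma)) = tau x * tau (rho * z).
  move=> Pz; rewrite tau_prod //; last by in_subalgebra Psub.
  by rewrite -sigma_rho // [in RHS](traceC tau_tracial).
by rewrite !prod // E_rho.
Qed.

(** The Schwarz remainders have nonnegative weighted trace, and [E] preserves both weights. The
    bound for [sigma] is Schwarz for [star y]. *)
Lemma cp_contracts y : M y -> [/\ N (E y), tau (rho * E y) = tau (rho * y),
  tau (sigma * (E y * star (E y))) <= tau (sigma * (y * star y))
  & tau (rho * (star (E y) * E y)) <= tau (rho * (star y * y))].
Proof.
move=> My; have Msy := subalgebra_star Msub My.
split; [exact: EN|exact: E_rho| |].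
- have [k [d [_ [_ _ + _ _]]]] := cp_schwarz Msub Nsub Ecp E1 Msy Msy.
  rewrite starK (cp_star Msub Ecp) // starK => eE.
  have Myy : M (y * star y) by in_subalgebra Msub.
  rewrite -(E_sigma Myy) eE mulrDr (traceD tau_tracial) lerDl.
  rewrite mulr_sumr (trace_sum tau_tracial); apply: sumr_ge0 => i _.
  exact: (weighted_trace_ge0 tau_tracial sigmaE).
- have [k [d [_ [_ _ + _ _]]]] := cp_schwarz Msub Nsub Ecp E1 My My.
  move=> eE; have Myy : M (star y * y) by in_subalgebra Msub.
  rewrite -(E_rho Myy) eE mulrDr (traceD tau_tracial) lerDl.
  rewrite mulr_sumr (trace_sum tau_tracial); apply: sumr_ge0 => i _.
  exact: (weighted_trace_ge0 tau_tracial rhoE).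
Qed.

Let sigmaME : spectral_resolution (@star R T) M sigma q f.
Proof. exact: spectral_resolution_sub PM sigmaE. Qed.

Let sigma_eq0 y : M y -> tau (sigma * (star y * y)) = 0 -> y = 0.
Proof. exact: (weighted_trace_eq0 tau_tracial Msub sigmaME). Qed.

Let Estar y : M y -> E (star y) = star (E y).
Proof. exact: (cp_star Msub Ecp). Qed.

(** Multiplicative domain: for a fixed point z, invariance and faithfulness of psi kill the Schwarz
    remainder, and with it the mixed one. *)
Let fixed_mul_right z y : M z -> E z = z -> M y -> E (y * z) = E y * z.
Proof.
move=> Mz Ez My; have Msy := subalgebra_star Msub My.
have [k [d [d' [_ Nd' _ dz yz]]]] := cp_schwarz Msub Nsub Ecp E1 Msy Mz.
have d'0 i : d' i = 0.
  have Mzz : M (star z * z) by in_subalgebra Msub.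
  have := E_sigma Mzz; rewrite dz Ez mulrDr (traceD tau_tracial).
  rewrite -[RHS]addr0 => /addrI; rewrite mulr_sumr (trace_sum tau_tracial).
  move/eqP; rewrite psumr_eq0 => [/allP/(_ i (mem_index_enum i))/eqP|j _].
    by apply: sigma_eq0; exact/NM/Nd'.
  exact: (weighted_trace_ge0 tau_tracial sigmaE).
move: yz; rewrite starK Ez Estar // starK => ->.
by rewrite big1 ?addr0 // => i _; rewrite d'0 mulr0.
Qed.

Let fixed_mul_left z y : M z -> E z = z -> M y -> E (z * y) = z * E y.
Proof.
move=> Mz Ez My; have Msy := subalgebra_star Msub My.
have Msz := subalgebra_star Msub Mz.
have Mszy : M (star y * star z) by in_subalgebra Msub.
have Esz : E (star z) = star z by rewrite Estar // Ez.
rewrite -[z * y]starK starM Estar // (fixed_mul_right Msz Esz Msy).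
by rewrite Estar // starM !starK.
Qed.

Let sigma_inv : T := calculus q f (fun r => (r^-1)%:C%C).

Let sigma_invK : sigma * sigma_inv = 1.
Proof.
rewrite -(calculus_id sigmaE) (calculusM sigmaE) -(calculus1 sigmaE).
apply: calculus_eq => j; rewrite -(rmorphM (real_complex R)) divff ?rmorph1 //.
by rewrite gt_eqF.
Qed.

Let sigma_inv_sigma : sigma_inv * sigma = 1.
Proof.
rewrite -(calculus_id sigmaE) (calculusM sigmaE) -(calculus1 sigmaE).
apply: calculus_eq => j; rewrite -(rmorphM (real_complex R)) mulVf ?rmorph1 //.
by rewrite gt_eqF.
Qed.

(* The KMS identity psi(y u) = psi(z y) for u = sigma z sigma^-1 shows that u is
   fixed by the adjoint of E for the inner product of psi, hence by E, which is a
   contraction for that inner product. *)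
Let fixed_modular z : M z -> E z = z ->
  let u := sigma * z * sigma_inv in M u /\ E u = u.
Proof.
move=> Mz Ez u.
have Msinv : M sigma_inv by exact: (calculus_in Msub sigmaME).
have Mu : M u by in_subalgebra Msub.
split=> //.
have kms y : tau (sigma * (y * u)) = tau (sigma * (z * y)).
  rewrite /u (traceC tau_tracial) -!mulrA sigma_inv_sigma mulr1.
  by rewrite (traceC tau_tracial) -mulrA.
have Msu := subalgebra_star Msub Mu; have MEu := EM Mu.
have cross : tau (sigma * (star (E u) * u)) = tau (sigma * (star u * u)).
  have Mzsu : M (z * star u) by in_subalgebra Msub.
  by rewrite kms -Estar // -fixed_mul_left // E_sigma // kms.
have sigma_star y : tau (sigma * star y) = (tau (sigma * y))^*%C.
  rewrite -(trace_star tau_tracial) starM (spectral_self_adjoint sigmaE).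
  by rewrite (traceC tau_tracial).
have real : (tau (sigma * (star u * u)))^*%C = tau (sigma * (star u * u)).
  by rewrite -sigma_star (starM (star u) u) starK.
have cross' : tau (sigma * (star u * E u)) = tau (sigma * (star u * u)).
  by rewrite -real -cross -sigma_star (starM (star (E u)) u) starK.
(* With both cross terms equal to the square norm of u, the square norm of E(u) - u is that of E(u)
   minus that of u, which is nonpositive by Schwarz. *)
apply/eqP; rewrite -subr_eq0; apply/eqP/sigma_eq0; first by in_subalgebra Msub.
apply/le_anti/andP; split; last exact: (weighted_trace_ge0 tau_tracial sigmaE).
rewrite starB mulrBl !mulrBr !(traceB tau_tracial) cross cross' subrr subr0.
rewrite subr_le0.
have [k [d [_ [_ _ eE _ _]]]] := cp_schwarz Msub Nsub Ecp E1 Mu Mu.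
have Muu : M (star u * u) by in_subalgebra Msub.
rewrite -(E_sigma Muu) eE mulrDr (traceD tau_tracial) lerDl.
rewrite mulr_sumr (trace_sum tau_tracial); apply: sumr_ge0 => i _.
exact: (weighted_trace_ge0 tau_tracial sigmaE).
Qed.

(** By induction every sigma^k x sigma^(-k) is a fixed point of [E]. The imaginary powers are linear
    combinations of these, since [cis (t * ln w)] is a function of the eigenvalue ratio w. *)
Lemma modular_flow_in x t : A x -> N (ipow sigma t * x * ipow sigma (- t)).
Proof.
move=> Ax; have Mx := AM Ax.
pose F := [set z | M z /\ E z = z].
have F0 : F 0.
  by split; [exact: subalgebra0|have := Elin (-1) (subalgebra1 Msub) (subalgebra1 Msub);
    rewrite scaleN1r addNr => ->; rewrite scaleN1r addNr].
have Flin (c : R[i]) y z : F y -> F z -> F (c *: y + z).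
  by move=> [My Ey] [Mz Ez]; split; [in_subalgebra Msub|rewrite Elin // Ey Ez].
suff [/EN + Ez] : F (ipow sigma t * x * ipow sigma (- t)) by rewrite Ez.
rewrite (ipow_sandwich _ _ sigmaE q_gt0).
apply: (power_sums_determine (w := fun k : 'I_m * 'I_m => (q k.1 / q k.2)%:C%C)) => //.
  by move=> k k' /complexI ->.
elim=> [|k IH].
  have -> : \sum_(i : 'I_m * 'I_m) (q i.1 / q i.2)%:C%C ^+ 0 *: (f i.1 * x * f i.2) = x.
    transitivity (sandwich q f q f x (fun _ _ => 1)); first by [].
    by rewrite (sandwich_left _ _ sigmaE x (fun=> 1)) (calculus1 sigmaE) mul1r.
  by split=> //; rewrite -{1}(mulr1 x) E_mod ?E1 ?mulr1 //; exact: subalgebra1.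
have [Mk Ek] := IH.
have := fixed_modular Mk Ek; set u := sigma * _ * _.
suff -> : u = \sum_(i : 'I_m * 'I_m)
    (q i.1 / q i.2)%:C%C ^+ k.+1 *: (f i.1 * x * f i.2) by [].
have := sandwich_ratio_exp x k sigmaE q_gt0; rewrite /sandwich => e'.
by rewrite /u e' -mulrA sigma_invK mulr1.
Qed.

End Forward.

(** * The recovery map *)

Section Backward.
Context (R : realType) (T : cstarAlgType R) (tau : T -> R[i]).
Hypothesis tau_tracial : tracial_state tau.
Variables (M N P Q A : set T) (rho rhoN sigma sigmaN : T) (C : T -> T).
Hypotheses (Msub : star_subalgebra M) (Nsub : star_subalgebra N).
Hypotheses (Psub : star_subalgebra P) (Qsub : star_subalgebra Q).
Hypotheses (NM : N `<=` M) (PM : P `<=` M) (QN : Q `<=` N) (AN : A `<=` N).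
Hypothesis C_in : forall x, M x -> N (C x).
Hypothesis C_Ml : forall x y, N y -> C (y * x) = y * C x.
Hypothesis C_Mr : forall x y, N y -> C (x * y) = C x * y.
Hypothesis C_P : forall x, P x -> Q (C x).
Hypothesis C_tau : forall x, tau (C x) = tau x.
Variables (n m n' m' : nat).
Variables (p : 'I_n -> R) (e : 'I_n -> T) (q : 'I_m -> R) (f : 'I_m -> T).
Variables (p' : 'I_n' -> R) (e' : 'I_n' -> T) (q' : 'I_m' -> R) (f' : 'I_m' -> T).
Hypothesis rhoE : spectral_resolution (@star R T) M rho p e.
Hypothesis sigmaE : spectral_resolution (@star R T) P sigma q f.
Hypothesis rhoNE : spectral_resolution (@star R T) N rhoN p' e'.
Hypothesis sigmaNE : spectral_resolution (@star R T) Q sigmaN q' f'.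
Hypotheses (p_gt0 : forall i, 0 < p i) (q_gt0 : forall j, 0 < q j).
Hypotheses (p'_gt0 : forall i, 0 < p' i) (q'_gt0 : forall j, 0 < q' j).
Hypothesis rhoN_rho : forall y, N y -> tau (rhoN * y) = tau (rho * y).
Hypothesis C_sigma : C sigma = sigmaN.
Hypothesis cocycle : calculus q f root_of * calculus p e inv_root_of =
  calculus q' f' root_of * calculus p' e' inv_root_of.
Hypothesis flow : forall x t, A x -> N (ipow sigma t * x * ipow sigma (- t)).

Let s : T := calculus q f root_of.
Let r : T := calculus q' f' inv_root_of.

(* The Accardi-Cecchini (Petz) recovery map of the inclusion of N into M for the
   state with density sigma. *)
Definition recovery (x : T) : T := r * C (s * x * s) * r.

Let Ps : P s. Proof. exact: (calculus_in Psub sigmaE). Qed.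
Let Ms : M s. Proof. exact: PM. Qed.
Let Qr : Q r. Proof. exact: (calculus_in Qsub sigmaNE). Qed.
Let Nr : N r. Proof. exact: QN. Qed.


Lemma recovery1 : recovery 1 = 1.
Proof.
rewrite /recovery mulr1 (calculus_root_sqr sigmaE) // C_sigma.
rewrite -(calculus_root_sqr sigmaNE) // mulrA (calculus_Vroot sigmaNE) // mul1r.
exact: (calculus_rootV sigmaNE).
Qed.

Lemma recovery_in x : M x -> N (recovery x).
Proof.
move=> Mx; have NC : N (C (s * x * s)) by apply: C_in; in_subalgebra Msub.
by rewrite /recovery; in_subalgebra Nsub.
Qed.

Lemma recovery_P x : P x -> Q (recovery x).
Proof.
move=> Px; have QC : Q (C (s * x * s)) by apply: C_P; in_subalgebra Psub.
by rewrite /recovery; in_subalgebra Qsub.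
Qed.

(** The cocycle identity reads rho_N^(1/2) r s = rho^(1/2), hence rho = s r rho_N r s; bimodularity
    and trace invariance of [C] reassemble these factors around x. *)
Lemma recovery_rho x : M x -> tau (rho * recovery x) = tau (rho * x).
Proof.
move=> Mx; rewrite -rhoN_rho; last exact: recovery_in.
pose h := calculus p e root_of; pose hN := calculus p' e' root_of.
have h_eq : hN * r * s = h.
  have := congr1 (fun y => hN * (r * y * h)) cocycle.
  rewrite -/s -!mulrA (calculus_Vroot rhoE) // mulr1 => ->.
  rewrite [r * _]mulrA (calculus_Vroot sigmaNE) // mul1r.
  by rewrite mulrA (calculus_rootV rhoNE) // mul1r.
have hs : star h = h by exact: (calculus_root_star rhoE).
have rho_eq : s * r * rhoN * r * s = rho.
  rewrite -(calculus_root_sqr rhoE) // -/h -{1}hs -h_eq !starM.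
  rewrite (calculus_root_star sigmaE) (calculus_Vroot_star sigmaNE).
  rewrite (calculus_root_star rhoNE) -/s -/r -/hN.
  by rewrite -(calculus_root_sqr rhoNE) // -/hN !mulrA.
have NrhoN : N rhoN.
  by rewrite -(calculus_id rhoNE); exact: (calculus_in Nsub rhoNE).
have Nrr : N (r * rhoN * r) by in_subalgebra Nsub.
rewrite /recovery !mulrA (traceC tau_tracial) !mulrA -(C_Ml _ Nrr) C_tau.
by rewrite -rho_eq !mulrA [LHS](traceC tau_tracial) !mulrA.
Qed.

(* For small t0, lambda |-> exp (i t0 lambda) separates the logarithms of the
   ratios of eigenvalues of sigma, so that the unitary flow at the times k t0
   determines the imaginary powers. *)
Let ratio_in x k : A x -> N (sandwich q f q f x (fun a b => (a / b)%:C%C ^+ k)).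
Proof.
move=> Ax; pose L (i : 'I_m * 'I_m) := ln (q i.1 / q i.2).
pose S := \sum_i `|L i|; have S0 : 0 <= S by apply: sumr_ge0.
(* This makes every |t0 L_i| at most 1 <= pi / 2, where the sine, and so [cis], is injective. *)
pose t0 : R := (1 + S)^-1.
have t00 : 0 < t0 by rewrite invr_gt0 ltr_pwDl.
have tL i : t0 * L i \in `[- (pi / 2), pi / 2].
  have : `|t0 * L i| <= 1.
    rewrite normrM gtr0_norm // mulrC ler_pdivrMr ?ltr_pwDl // mul1r.
    rewrite ler_wpDl // /S (bigD1 i) //= lerDl; exact: sumr_ge0.
  rewrite in_itv /= -ler_norml => /le_trans; apply.
  by rewrite ler_pdivlMr ?mul1r ?pi_ge2.
apply: (power_sums_determine (w := fun i => cis (t0 * L i))).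
- exact: subalgebra0.
- by move=> c y z; exact: subalgebra_lin.
- move=> i j [_ /sin_inj]; move=> /(_ (tL i) (tL j)).
  have /lt0r_neq0/mulfI/[apply] := t00.
  by move=> /ln_inj; rewrite !posrE !divr_gt0 // => /(_ isT isT) ->.
- move=> j; have := flow (t0 *+ j) Ax.
  rewrite (ipow_sandwich _ _ sigmaE q_gt0) /sandwich.
  suff -> : \sum_(i : 'I_m * 'I_m) cis (t0 *+ j * ln (q i.1 / q i.2)) *: (f i.1 * x * f i.2)
      = \sum_i cis (t0 * L i) ^+ j *: (f i.1 * x * f i.2) by [].
  by apply: eq_bigr => i _; rewrite -cis_nat mulrnAl.
Qed.

(** Let z_k = sigma^k x sigma^(-k) and apply [C] to sigma z_k = z_(k+1) sigma. Since z_k and z_(k+1)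
    lie in [N], only sigma changes, into sigma_N, and the two recursions coincide. *)
Let ratio_eq x k : A x -> sandwich q f q f x (fun a b => (a / b)%:C%C ^+ k) =
  sandwich q' f' q' f' x (fun a b => (a / b)%:C%C ^+ k).
Proof.
move=> Ax; elim: k => [|k IH].
  rewrite (sandwich_left _ _ sigmaE x (fun=> 1)) (calculus1 sigmaE).
  by rewrite (sandwich_left _ _ sigmaNE x (fun=> 1)) (calculus1 sigmaNE).
have := congr1 C (sandwich_ratio_exp x k sigmaE q_gt0).
rewrite C_Mr ?C_Ml ?C_sigma; do ?exact: ratio_in.
rewrite IH (sandwich_ratio_exp x k sigmaNE q'_gt0) => /(congr1 (fun y => y * r * r)).
have srr : sigmaN * r * r = 1.
  rewrite -(calculus_root_sqr sigmaNE) // -!mulrA [_ * (r * r)]mulrA.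
  by rewrite (calculus_rootV sigmaNE) // mul1r (calculus_rootV sigmaNE).
by rewrite -!mulrA [sigmaN * _]mulrA srr !mulr1.
Qed.

Let sN : T := calculus q' f' root_of.

(** From integer powers to the square root: with both families of eigenvalue ratios on one index
    set, [power_sums_determine] for the zero subspace shows that Ad sigma^(1/2) and Ad sigma_N^(1/2)
    agree on x. *)
Let root_flow x : A x -> s * x = sN * x * r * s.
Proof.
move=> Ax; pose I := ('I_m * 'I_m + 'I_m' * 'I_m')%type.
pose w (i : I) : R := match i with inl k => q k.1 / q k.2 | inr k => q' k.1 / q' k.2 end.
have w0 i : 0 < w i by case: i => k; rewrite divr_gt0.
pose v (i : I) := match i with
  | inl k => f k.1 * x * f k.2 | inr k => - (f' k.1 * x * f' k.2) end.
have sumE g : \sum_i g (w i) *: v i =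
    sandwich q f q f x (fun a b => g (a / b))
    - sandwich q' f' q' f' x (fun a b => g (a / b)).
  rewrite big_sumType /=; congr (_ + _).
  by rewrite /sandwich -sumrN; apply: eq_bigr => k _; rewrite scalerN.
have : \sum_i root_of (w i) *: v i = 0.
  apply: (power_sums_determine (S := [set 0]) (w := fun i => (w i)%:C%C)) => //=.
  - by move=> c y z -> ->; rewrite scaler0 addr0.
  - by move=> i j /complexI ->.
  - by move=> k; rewrite (sumE (fun a => a%:C%C ^+ k)) ratio_eq // subrr.
rewrite sumE => /eqP; rewrite subr_eq0 => /eqP.
have rootE S y k (a : 'I_k -> R) (u : 'I_k -> T) :
    spectral_resolution (@star R T) S y a u -> (forall i, 0 < a i) ->
    sandwich a u a u x (fun a b => root_of (a / b))
    = calculus a u root_of * x * calculus a u inv_root_of.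
  move=> yau a0; rewrite calculus_sandwich; apply: sandwich_eq => j i.
  rewrite /root_of /inv_root_of sqrtrM ?sqrtrV ?ltW //.
  by rewrite (rmorphM (real_complex R)).
rewrite (rootE _ _ _ _ _ sigmaE) // (rootE _ _ _ _ _ sigmaNE) // -/sN -/r -/s => <-.
by rewrite -mulrA (calculus_Vroot sigmaE) // mulr1.
Qed.

(** The factor x crosses sigma^(1/2) as the element sN x r of [N], which comes out of [C]; then r sN
    = 1. *)
Lemma recovery_mod x y : A x -> M y -> recovery (x * y) = x * recovery y.
Proof.
move=> Ax My; have Nx := AN Ax.
have NsN : N sN by apply/QN; exact: (calculus_in Qsub sigmaNE).
have Nx' : N (sN * x * r) by in_subalgebra Nsub.
have -> : recovery (x * y) = r * (sN * x * r * C (s * y * s)) * r.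
  by rewrite /recovery [s * (x * y)]mulrA root_flow // -(C_Ml _ Nx') !mulrA.
by rewrite /recovery !mulrA (calculus_Vroot sigmaNE) // mul1r.
Qed.

End Backward.

(** * Matrices over a star-algebra *)

(* Square matrices over T as an algebra over the scalars of T: the canonical
   module structure of matrices has T itself as scalars. *)
Definition cmx (R : realType) (T : cstarAlgType R) (n : nat) : Type := 'M[T]_n.+1.

Section MatrixAlgebra.
Context (R : realType) (T : cstarAlgType R) (n : nat).
Local Notation MT := (cmx T n).

HB.instance Definition _ := GRing.NzRing.copy MT 'M[T]_n.+1.

Definition cmx_scale (c : R[i]) (X : MT) : MT := map_mx (GRing.scale c) X.

Let scaleA a b (X : MT) : cmx_scale a (cmx_scale b X) = cmx_scale (a * b) X.
Proof. by apply/matrixP => i j; rewrite !mxE scalerA. Qed.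

Let scale1 : left_id 1 cmx_scale.
Proof. by move=> X; apply/matrixP => i j; rewrite !mxE scale1r. Qed.

Let scaleDr : right_distributive cmx_scale +%R.
Proof. by move=> c X Y; apply/matrixP => i j; rewrite !mxE scalerDr. Qed.

Let scaleDl (X : MT) : {morph cmx_scale^~ X : a b / a + b}.
Proof. by move=> a b; apply/matrixP => i j; rewrite !mxE scalerDl. Qed.

HB.instance Definition _ :=
  GRing.Zmodule_isLmodule.Build R[i] MT scaleA scale1 scaleDr scaleDl.

Let scaleAl (c : R[i]) (X Y : MT) : c *: (X * Y) = (c *: X) * Y.
Proof.
apply/matrixP => i j; rewrite !mxE scaler_sumr; apply: eq_bigr => k _.
by rewrite !mxE scalerAl.
Qed.

HB.instance Definition _ := GRing.Lmodule_isLalgebra.Build R[i] MT scaleAl.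

Let scaleAr (c : R[i]) (X Y : MT) : c *: (X * Y) = X * (c *: Y).
Proof.
apply/matrixP => i j; rewrite !mxE scaler_sumr; apply: eq_bigr => k _.
by rewrite !mxE scalerAr.
Qed.

HB.instance Definition _ := GRing.Lalgebra_isAlgebra.Build R[i] MT scaleAr.

Definition cmx_star (X : MT) : MT := (map_mx (@star R T) X)^T.

Lemma cmx_starE X i j : cmx_star X i j = star (X j i).
Proof. by rewrite !mxE. Qed.

Lemma cmx_mulE (X Y : MT) i j : (X * Y) i j = \sum_k X i k * Y k j.
Proof. by rewrite mxE. Qed.

Lemma cmx_scaleE c (X : MT) i j : (c *: X) i j = c *: X i j.
Proof. by rewrite mxE. Qed.

Lemma cmx_starK : involutive cmx_star.
Proof. by move=> X; apply/matrixP => i j; rewrite !cmx_starE starK. Qed.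

Lemma cmx_star_lin (c : R[i]) (X Y : MT) :
  cmx_star (c *: X + Y) = (c^*)%C *: cmx_star X + cmx_star Y.
Proof.
apply/matrixP => i j; rewrite [RHS]mxE cmx_scaleE !cmx_starE mxE.
by rewrite cmx_scaleE star_semilinear.
Qed.

Lemma cmx_starM (X Y : MT) : cmx_star (X * Y) = cmx_star Y * cmx_star X.
Proof.
apply/matrixP => i j; rewrite cmx_starE !cmx_mulE star_sum.
by apply: eq_bigr => k _; rewrite starM !cmx_starE.
Qed.

Definition cmx_over (S : set T) : set MT := [set X | forall i j, S (X i j)].

Section Over.
Variable S : set T.
Hypothesis Ssub : star_subalgebra S.

Lemma cmx_over1 : cmx_over S 1.
Proof.
move=> i j; rewrite mxE; case: (i == j); first exact: subalgebra1.
exact: subalgebra0.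
Qed.

Lemma cmx_over_lin (c : R[i]) (X Y : MT) :
  cmx_over S X -> cmx_over S Y -> cmx_over S (c *: X + Y).
Proof. by move=> SX SY i j; rewrite mxE cmx_scaleE; apply: (subalgebra_lin Ssub). Qed.

Lemma cmx_overM (X Y : MT) :
  cmx_over S X -> cmx_over S Y -> cmx_over S (X * Y).
Proof.
move=> SX SY i j; rewrite cmx_mulE; apply: (subalgebra_sum Ssub) => k _.
by apply: (subalgebraM Ssub).
Qed.

Lemma cmx_over_span : finite_span S -> finite_span (cmx_over S).
Proof.
move=> [N [w wP]]; pose I := ('I_N * 'I_n.+1 * 'I_n.+1)%type.
pose W (k : I) : MT := \matrix_(i, j) if (i == k.1.2) && (j == k.2) then w k.1.1 else 0.
exists #|{: I}|, (fun k => W (enum_val k)) => X SX.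
have [d dP] := choice (fun ij : 'I_n.+1 * 'I_n.+1 => wP _ (SX ij.1 ij.2)).
exists (fun k => d ((enum_val k).1.2, (enum_val k).2) (enum_val k).1.1).
rewrite -(big_enum_val (A := {: I}) (fun k : I => d (k.1.2, k.2) k.1.1 *: W k)) /=.
apply/matrixP => i j; rewrite (dP (i, j)) summxE /=.
rewrite (bigID (fun k : I => (k.1.2 == i) && (k.2 == j))) /= [X in _ = _ + X]big1.
  rewrite addr0 (reindex_onto (fun a => (a, i, j) : I) (fun k => k.1.1)) /=.
    apply: eq_big => [a|a _]; first by rewrite !eqxx.
    by rewrite cmx_scaleE mxE !eqxx.
  by case=> [[a i'] j'] /= /andP[/eqP -> /eqP ->].
move=> [[a i'] j'] /= h; rewrite cmx_scaleE mxE /=.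
by rewrite (eq_sym i) (eq_sym j) (negbTE h) scaler0.
Qed.

Lemma cmx_over_definite (tau : T -> R[i]) : tracial_state tau ->
  (forall y, S y -> tau (star y * y) = 0 -> y = 0) ->
  forall X, cmx_over S X -> \sum_i tau ((cmx_star X * X) i i) = 0 -> X = 0.
Proof.
move=> ht Sf X SX.
have ge0 i : 0 <= tau ((cmx_star X * X) i i).
  rewrite cmx_mulE (trace_sum ht) sumr_ge0 // => k _.
  by rewrite cmx_starE trace_ge0.
move=> /eqP; rewrite psumr_eq0 // => /allP h.
apply/matrixP => k i; rewrite [RHS]mxE; apply: Sf => //.
have := h i (mem_index_enum i); rewrite cmx_mulE (trace_sum ht) psumr_eq0.
  by move=> /allP/(_ k (mem_index_enum k))/eqP; rewrite cmx_starE.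
by move=> j _; rewrite cmx_starE trace_ge0.
Qed.

(** On a spectral projection of X the trace test yields the eigenvalue times a positive number. So
    the eigenvalues are nonnegative, and Z is the square root of X. *)
Lemma cmx_square (tau : T -> R[i]) (X : MT) : tracial_state tau ->
  (forall y, S y -> tau (star y * y) = 0 -> y = 0) -> finite_span S ->
  cmx_over S X -> cmx_star X = X ->
  (forall Y : MT, cmx_over S Y -> 0 <= \sum_i tau ((cmx_star Y * X * Y) i i)) ->
  exists2 Z : MT, cmx_over S Z & X = cmx_star Z * Z.
Proof.
move=> ht Sf Sfin SX Xs Xpos.
have Sstar Y : cmx_over S Y -> cmx_star Y * Y = 0 -> Y = 0.
  move=> SY Y0; apply: (cmx_over_definite ht Sf) => //.
  by rewrite Y0 big1 // => i _; rewrite mxE (trace0 ht).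
have [k [l [p xlp]]] := spectral_theorem cmx_starK cmx_star_lin cmx_starM
  cmx_over1 cmx_over_lin cmx_overM Sstar (cmx_over_span Sfin) SX Xs.
have l0 j : 0 <= l j.
  have Sp := spectral_in xlp j; have := Xpos _ Sp.
  have -> : cmx_star (p j) * X * p j = (l j)%:C%C *: (cmx_star (p j) * p j).
    rewrite (spectral_star xlp) {1}(spectral_sum xlp) mulr_sumr mulr_suml.
    rewrite (bigD1 j) //= big1 => [|i ij].
      by rewrite addr0 -scalerAr -scalerAl !(spectral_orth xlp) eqxx
        (spectral_orth xlp) eqxx.
    by rewrite -scalerAr (spectral_orth xlp) eq_sym (negbTE ij) scaler0 mul0r.
  rewrite (eq_bigr (fun i => (l j)%:C%C * tau ((cmx_star (p j) * p j) i i))); last first.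
    by move=> i _; rewrite cmx_scaleE (traceZ ht).
  rewrite -mulr_sumr; set d := \sum_i _.
  have d0 : 0 <= d.
    apply: sumr_ge0 => i _; rewrite cmx_mulE (trace_sum ht) sumr_ge0 // => h _.
    by rewrite cmx_starE trace_ge0.
  have dn0 : d != 0.
    apply: contra (spectral_neq0 xlp j) => /eqP.
    by move=> /(cmx_over_definite ht Sf Sp) ->.
  by rewrite pmulr_lge0 ?ler0c // lt_neqAle eq_sym dn0 d0.
pose Z := \sum_j root_of (l j) *: p j.
have Zs : cmx_star Z = Z.
  have star0 : cmx_star 0 = 0 by apply/matrixP => i j; rewrite !mxE star0.
  have starD' (U V : MT) : cmx_star (U + V) = cmx_star U + cmx_star V.
    by apply/matrixP => i j; rewrite !mxE starD.
  rewrite /Z (big_morph _ starD' star0); apply: eq_bigr => j _.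
  by rewrite -[_ *: p j]addr0 cmx_star_lin (spectral_star xlp) star0 conjc_real.
exists Z.
  rewrite /Z; elim/big_rec: _ => [i j|j Y _ SY].
    by rewrite mxE; exact: subalgebra0.
  by apply: cmx_over_lin => //; exact: (spectral_in xlp).
rewrite Zs [LHS](spectral_sum xlp) /Z mulr_suml; apply: eq_bigr => j _.
rewrite mulr_sumr (bigD1 j) //= big1 => [|i ij].
  rewrite addr0 -scalerAl -scalerAr (spectral_orth xlp) eqxx scalerA.
  by rewrite -(rmorphM (real_complex R)) -expr2 sqr_sqrtr.
by rewrite -scalerAl -scalerAr (spectral_orth xlp) eq_sym (negbTE ij) !scaler0.
Qed.

End Over.
End MatrixAlgebra.

(** * Markov triplets *)

(** Against a test matrix W, the bimodule property absorbs [r] and the entries of W into [C], and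
    trace invariance removes [C]. What remains is a sum of squares, so [cmx_square] provides the
    factorization. *)
Lemma cp_conjugated_condexp (R : realType) (T : cstarAlgType R) (tau : T -> R[i])
    (M N : set T) (C : T -> T) (s r : T) :
  tracial_state tau -> star_subalgebra M -> star_subalgebra N ->
  (forall y, N y -> tau (star y * y) = 0 -> y = 0) -> finite_span N ->
  (forall (c : R[i]) x y, C (c *: x + y) = c *: C x + C y) ->
  (forall x, M x -> N (C x)) -> (forall x, star (C x) = C (star x)) ->
  (forall x y, N y -> C (y * x) = y * C x) ->
  (forall x y, N y -> C (x * y) = C x * y) ->
  (forall x, tau (C x) = tau x) ->
  M s -> star s = s -> N r -> star r = r ->
  completely_positive M N (fun x => r * C (s * x * s) * r).
Proof.
move=> ht Msub Nsub Nf Nfin C_lin C_in C_star C_Ml C_Mr C_tau Ms ss Nr rr.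
have F_in x : M x -> N (r * C (s * x * s) * r).
  move=> Mx; have NC : N (C (s * x * s)) by apply: C_in; in_subalgebra Msub.
  by in_subalgebra Nsub.
split=> //.
  move=> c x y _ _; rewrite mulrDr mulrDl -scalerAr -scalerAl C_lin mulrDr mulrDl.
  by rewrite -scalerAr -scalerAl.
move=> [|n] X [Y [MY XE]].
  by exists 0; split=> [[]//|]; apply/matrixP => -[].
pose X' : cmx T n := map_mx (fun x => r * C (s * x * s) * r) X.
have XijE i j : X i j = \sum_k star (Y k i) * Y k j.
  by rewrite XE mxE; apply: eq_bigr => k _; rewrite !mxE.
have MX i j : M (X i j) by rewrite XijE; in_subalgebra Msub.
have X'E i j : X' i j = r * C (s * X i j * s) * r by rewrite mxE.
have NX' : cmx_over N X' by move=> i j; rewrite X'E; exact: F_in.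
have X's : cmx_star X' = X'.
  apply/matrixP => i j; rewrite cmx_starE !X'E !starM C_star !starM ss rr !mulrA.
  congr (_ * C (_ * _ * _) * _); rewrite !XijE star_sum.
  by apply: eq_bigr => k _; rewrite starM starK.
suff [Z NZ ZE] : exists2 Z : cmx T n, cmx_over N Z & X' = cmx_star Z * Z.
  by exists Z.
apply: (cmx_square Nsub ht) => // W NW; apply: sumr_ge0 => i _.
(* Entry (k, i) of the product Y W with s r inserted between the factors. *)
pose u k := \sum_j Y k j * s * r * W j i.
have -> : tau ((cmx_star W * X' * W) i i) = \sum_k tau (star (u k) * u k).
  transitivity (\sum_j \sum_h \sum_k
      tau (star (Y k h * s * r * W h i) * (Y k j * s * r * W j i))).
    rewrite cmx_mulE (trace_sum ht); apply: eq_bigr => j _.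
    rewrite cmx_mulE mulr_suml (trace_sum ht); apply: eq_bigr => h _.
    have NWh : N (star (W h i) * r) by have := NW h i; move=> ?; in_subalgebra Nsub.
    have NWj : N (r * W j i) by have := NW j i; move=> ?; in_subalgebra Nsub.
    rewrite cmx_starE X'E !mulrA -(C_Ml _ _ NWh) -mulrA -(C_Mr _ _ NWj) C_tau.
    rewrite XijE !(mulr_sumr, mulr_suml) (trace_sum ht); apply: eq_bigr => k _.
    by rewrite !starM ss rr !mulrA.
  rewrite (eq_bigr (fun j => \sum_k \sum_h
      tau (star (Y k h * s * r * W h i) * (Y k j * s * r * W j i)))).
    rewrite exchange_big /=; apply: eq_bigr => k _.
    rewrite /u star_sum mulr_sumr (trace_sum ht); apply: eq_bigr => j _.
    by rewrite mulr_suml (trace_sum ht).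
  by move=> j _; rewrite exchange_big.
by apply: sumr_ge0 => k _; exact: trace_ge0.
Qed.

(** The density is self-adjoint because phi is hermitian, and l_k > 0 because phi(p_k) = l_k
    tau(p_k), where faithfulness makes both values positive. *)
Lemma spectral_density (R : realType) (T : cstarAlgType R) (tau phi : T -> R[i])
    (S : set T) : tracial_state tau -> star_subalgebra S ->
  (forall y, S y -> tau (star y * y) = 0 -> y = 0) -> finite_span S ->
  (forall g : T -> R[i], linear_on (V := R[i]^o) S g ->
    exists2 rho, S rho & forall x, S x -> g x = tau (rho * x)) ->
  faithful_state_on S phi ->
  let rho := density tau S phi in
  (forall x, S x -> phi x = tau (rho * x)) /\
  exists n (l : 'I_n -> R) (p : 'I_n -> T),
    spectral_resolution (@star R T) S rho l p /\ forall k, 0 < l k.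
Proof.
move=> ht Ssub Sf Sfin Sriesz [phi_state phi_faithful] rho.
have [Srho rhoP] : is_density tau S phi rho.
  have [|rho' Srho' rho'P] := Sriesz phi; first by case: phi_state.
  by rewrite /rho /density; case: xgetP => [? _ //|/(_ rho')]; case.
split=> //.
have rho_star : star rho = rho.
  apply/eqP; rewrite -subr_eq0; apply/eqP; set d := _ - _.
  have Sd : S d by rewrite /d; in_subalgebra Ssub.
  apply: Sf => //; rewrite (traceC ht).
  have Ssd := subalgebra_star Ssub Sd.
  rewrite {1}/d mulrBl (traceB ht) -rhoP //.
  have -> : star rho * star d = star (d * rho) by rewrite starM.
  rewrite (trace_star ht) (traceC ht) -rhoP //.
  by rewrite -(state_on_star Ssub phi_state) // subrr.
have [n [l [p rhoE]]] := spectral_theorem (@starK R T)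
  (@star_semilinear R T) (@starM R T) (subalgebra1 Ssub)
  (@subalgebra_lin _ _ _ Ssub) (@subalgebraM _ _ _ Ssub)
  (fun y _ => @star_mul_eq0 _ _ y) Sfin Srho rho_star.
exists n, l, p; split=> // k.
have Sp := spectral_in rhoE k.
have phip : phi (star (p k) * p k) = (l k)%:C%C * tau (star (p k) * p k).
  rewrite (spectral_star rhoE) (spectral_orth rhoE) eqxx rhoP //.
  rewrite {1}(spectral_sum rhoE) mulr_suml (bigD1 k) //= big1 => [|j jk].
    by rewrite addr0 -scalerAl (spectral_orth rhoE) eqxx (traceZ ht).
  by rewrite -scalerAl (spectral_orth rhoE) (negbTE jk) scaler0.
have pn0 := spectral_neq0 rhoE k.
have tau_gt0 : 0 < tau (star (p k) * p k).
  rewrite lt_neqAle (trace_ge0 ht) andbT eq_sym.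
  by apply: contra pn0 => /eqP/(Sf _ Sp) ->.
have phi_gt0 : 0 < phi (star (p k) * p k).
  case: phi_state => _ /(_ _ Sp) phi0 _; rewrite lt_neqAle phi0 andbT eq_sym.
  by apply: contra pn0 => /eqP/(phi_faithful _ Sp) ->.
by move: phi_gt0; rewrite phip pmulr_lgt0 // ltcR.
Qed.

Lemma faithful_state_sub (R : realType) (T : cstarAlgType R) (S S' : set T)
  (phi : T -> R[i]) : S' `<=` S -> faithful_state_on S phi -> faithful_state_on S' phi.
Proof.
move=> S'S [[lin pos one] f]; split; last by move=> x /S'S/f.
by split=> // [c x y /S'S Sx /S'S Sy|x /S'S/pos]; first exact: lin.
Qed.

Theorem theorem4 (R : realType) (T : cstarAlgType R) (a : int -> T)
  (car : is_CAR a)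
  (tau : T -> R[i]) (tau_tracial : tracial_state tau)
  (A B C : set int)
  (finA : finite_set A) (finB : finite_set B) (finC : finite_set C)
  (disjAB : A `&` B = set0) (disjAC : A `&` C = set0)
  (disjBC : B `&` C = set0)
  (phi : T -> R[i])
  (phi_state : faithful_state_on (local_algebra a (A `|` B `|` C)) phi) :
  markov_triplet a A B C phi <->
  (ssa_equality a tau A B C phi /\
   local_algebra a A `<=` modular_subalgebra a tau A B C phi).
Proof.
pose c := majorana a.
have c_star : forall k, star (c k) = c k := majorana_star a.
have c_sqr : forall k, c k * c k = 1 := majorana_sqr car.
have c_anti := majorana_anti car.
have fresh := mode_fresh.
have modesP (I : set int) : finite_set I ->
    exists2 K : seq (int * bool), uniq K & forall k, k \in K <-> I k.1.
  move=> /finite_seqP[s ->]; exists (modes (undup s)).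
    exact/modes_uniq/undup_uniq.
  by move=> k; rewrite mem_modes mem_undup.
have [KA uA KAP] := modesP A finA; have [KB uB KBP] := modesP B finB.
have [KC uC KCP] := modesP C finC.
have disj (I J : set int) (KI KJ : seq (int * bool)) : I `&` J = set0 ->
    (forall k, k \in KI <-> I k.1) -> (forall k, k \in KJ <-> J k.1) ->
    {in KI, forall k : int * bool, k \notin KJ}.
  move=> IJ KIP KJP k /KIP Ik; apply/negP => /KJP Jk.
  by have : (I `&` J) k.1 by []; rewrite IJ.
have dAB := disj _ _ _ _ disjAB KAP KBP; have dAC := disj _ _ _ _ disjAC KAP KCP.
have dBC := disj _ _ _ _ disjBC KBP KCP.
have dCA : {in KC, forall k, k \notin KA}.
  by move=> k kC; apply/negP => /dAC/negP; apply.
have dCB : {in KC, forall k, k \notin KB}.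
  by move=> k kC; apply/negP => /dBC/negP; apply.
have uniqU (K L : seq (int * bool)) : uniq K -> uniq L ->
    {in K, forall k, k \notin L} -> uniq (K ++ L).
  move=> uK uL KL; rewrite cat_uniq uK uL andbT; apply/hasPn => k kL.
  by apply/negP => /KL; rewrite kL.
have dC_AB : {in KC, forall k, k \notin KA ++ KB}.
  by move=> k kC; rewrite mem_cat negb_or dCA ?dCB.
have dA_CB : {in KA, forall k, k \notin KC ++ KB}.
  by move=> k kA; rewrite mem_cat negb_or dAC ?dAB.
have uAB := uniqU _ _ uA uB dAB; have uCB := uniqU _ _ uC uB dCB.
have uM := uniqU _ _ uC uAB dC_AB; have uM' := uniqU _ _ uA uCB dA_CB.
set M := local_algebra a (A `|` B `|` C) in phi_state *.
set N := local_algebra a (A `|` B); set P := local_algebra a (B `|` C).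
set Q := local_algebra a B; set LA := local_algebra a A.
(* Two orders of the modes: C first, so that averaging over C maps [M] to [N]; then, in [ME'], A
   first, so that [M] is spanned by products from [LA] and [P]. *)
have ME : M = clifford c (KC ++ (KA ++ KB)).
  apply: (local_algebra_clifford car uM) => k; rewrite !mem_cat; split.
    by case/or3P => [/KCP|/KAP|/KBP] h; [right|left; left|left; right].
  by case=> [[/KAP ->|/KBP ->]|/KCP ->]; rewrite ?orbT.
have ME' : M = clifford c (KA ++ (KC ++ KB)).
  apply: (local_algebra_clifford car uM') => k; rewrite !mem_cat; split.
    by case/or3P => [/KAP|/KCP|/KBP] h; [left; left|right|left; right].
  by case=> [[/KAP ->|/KBP ->]|/KCP ->]; rewrite ?orbT.
have NE : N = clifford c (KA ++ KB).
  apply: (local_algebra_clifford car uAB) => k; rewrite mem_cat; split.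
    by case/orP => [/KAP|/KBP] h; [left|right].
  by case=> [/KAP ->|/KBP ->]; rewrite ?orbT.
have PE : P = clifford c (KC ++ KB).
  apply: (local_algebra_clifford car uCB) => k; rewrite mem_cat; split.
    by case/orP => [/KCP|/KBP] h; [right|left].
  by case=> [/KBP ->|/KCP ->]; rewrite ?orbT.
have QE : Q = clifford c KB by exact: (local_algebra_clifford car uB).
have LAE : LA = clifford c KA by exact: (local_algebra_clifford car uA).
have mono (I J : set int) : I `<=` J -> local_algebra a I `<=` local_algebra a J.
  move=> IJ x Ix S [Ssub JS]; apply: Ix; split=> // _ [i Ii <-].
  by apply: JS; exists i => //; exact: IJ.
have NM : N `<=` M by apply: mono => x; left.
have PM : P `<=` M by apply: mono => x [Bx|Cx]; [left; right|right].
have QN : Q `<=` N by apply: mono => x; right.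
have QP : Q `<=` P by apply: mono => x; left.
have AN : LA `<=` N by apply: mono => x; left.
have sub K : uniq K -> star_subalgebra (clifford c K).
  exact: clifford_subalgebra.
have faith K : uniq K -> forall y, clifford c K y -> tau (star y * y) = 0 -> y = 0.
  by move=> uK y; exact: (trace_faithful c_star c_sqr c_anti fresh tau_tracial).
have span K : finite_span (clifford c K) by exact: clifford_span.
have rz K : uniq K -> forall g : T -> R[i], linear_on (V := R[i]^o) (clifford c K) g ->
    exists2 rho, clifford c K rho & forall x, clifford c K x -> g x = tau (rho * x).
  by move=> uK g; exact: (riesz c_star c_sqr c_anti fresh tau_tracial).
have dens K : uniq K -> clifford c K `<=` M ->
    let rho := density tau (clifford c K) phi in
    (forall x, clifford c K x -> phi x = tau (rho * x)) /\
    exists n (l : 'I_n -> R) (p : 'I_n -> T),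
      spectral_resolution (@star R T) (clifford c K) rho l p /\ forall k, 0 < l k.
  move=> uK KM; apply: spectral_density => //; [exact: sub|exact: faith|exact: rz|].
  exact: faithful_state_sub phi_state.
have Msub : star_subalgebra M by rewrite ME; exact: sub.
have Nsub : star_subalgebra N by rewrite NE; exact: sub.
have Psub : star_subalgebra P by rewrite PE; exact: sub.
have Qsub : star_subalgebra Q by rewrite QE; exact: sub.
have Mf : forall y, M y -> tau (star y * y) = 0 -> y = 0 by rewrite ME; exact: faith.
have Nf : forall y, N y -> tau (star y * y) = 0 -> y = 0 by move=> y /NM; exact: Mf.
have := dens _ uM; rewrite -ME => /(_ (fun _ => id))[rhoP [n [p [e [rhoE p0]]]]].
have := dens _ uAB; rewrite -NE => /(_ NM)[rhoNP [n' [p' [e' [rhoNE p'0]]]]].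
have := dens _ uCB; rewrite -PE => /(_ PM)[sigmaP [m [q [f [sigmaE q0]]]]].
have := dens _ uB; rewrite -QE => /(_ (fun x h => NM _ (QN _ h))).
move=> [sigmaNP [m' [q' [f' [sigmaNE q'0]]]]].
set rho := density tau M phi in rhoP rhoE.
set rhoN := density tau N phi in rhoNP rhoNE.
set sigma := density tau P phi in sigmaP sigmaE.
set sigmaN := density tau Q phi in sigmaNP sigmaNE.
have [l lM] := fresh (KC ++ (KA ++ KB)).
have lAB : l \notin KA ++ KB by move: lM; rewrite mem_cat negb_or => /andP[].
have lCB : l \notin KC ++ KB.
  by move: lM; rewrite !mem_cat !negb_or => /and3P[-> _ ->].
pose CE := condexp c l KC.
have CE_lin (z : R[i]) x y : CE (z *: x + y) = z *: CE x + CE y.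
  exact: condexp_lin.
have CE_in x : M x -> N (CE x).
  by rewrite ME NE; exact: (condexp_in c_sqr c_anti).
have CE_P x : P x -> Q (CE x).
  by rewrite PE QE; exact: (condexp_in c_sqr c_anti).
have CE_star x : star (CE x) = CE (star x) by exact: condexp_star.
have CE_tau x : tau (CE x) = tau x by exact: (trace_condexp c_sqr).
have CE_Ml x y : N y -> CE (y * x) = y * CE x.
  by rewrite NE => Ny; exact: (condexpMl c_sqr c_anti x Ny).
have CE_Mr x y : N y -> CE (x * y) = CE x * y.
  by rewrite NE => Ny; exact: (condexpMr c_sqr c_anti x Ny).
have rhoN_rho y : N y -> tau (rhoN * y) = tau (rho * y).
  by move=> Ny; rewrite -rhoNP // -rhoP //; exact: NM.
have sigma_rho y : P y -> tau (sigma * y) = tau (rho * y).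
  by move=> Py; rewrite -sigmaP // -rhoP //; exact: PM.
(* Averaging over C sends [sigma] into [Q], where it represents phi just as [sigmaN] does;
   faithfulness of tau is applied to the difference. *)
have CE_sigma : CE sigma = sigmaN.
  apply/eqP; rewrite -subr_eq0; apply/eqP; set d := _ - _.
  have Psigma : P sigma.
    by rewrite -(calculus_id sigmaE); exact: (calculus_in Psub sigmaE).
  have Qsigma := CE_P _ Psigma.
  have QsigmaN : Q sigmaN.
    by rewrite -(calculus_id sigmaNE); exact: (calculus_in Qsub sigmaNE).
  have Qd : Q d by rewrite /d; in_subalgebra Qsub.
  have Qsd := subalgebra_star Qsub Qd.
  apply: Nf; first exact: QN.
  rewrite (traceC tau_tracial) {1}/d mulrBl (traceB tau_tracial).
  rewrite -(CE_Mr _ _ (QN _ Qsd)) CE_tau -sigmaNP // -sigmaP ?subrr //.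
  exact: QP.
have sigmaN_sigma y : N y -> tau (sigmaN * y) = tau (sigma * y).
  by move=> Ny; rewrite -CE_sigma -CE_Mr // CE_tau.
have sigmaME := spectral_resolution_sub PM sigmaE.
have sigmaNNE := spectral_resolution_sub QN sigmaNE.
pose ln_ (t : R) : R[i] := (ln t)%:C%C.
pose V g := defect p e q f p' e' q' f' g.
have entropyE S k (b : 'I_k -> R) (u : 'I_k -> T) :
    spectral_resolution (@star R T) S (density tau S phi) b u ->
    entropy tau S phi = - tau (density tau S phi * calculus b u ln_).
  by move=> h; rewrite /entropy /log (fcalcE h).
(* The logarithm of each marginal density lies in its own subalgebra, so its trace against that
   density may be taken against [rho]; the four entropies then combine to the logarithmic defect. *)
have ssaE : ssa_equality a tau A B C phi <-> tau (rho * V ln_) = 0.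
  rewrite /ssa_equality (entropyE _ _ _ _ rhoE) (entropyE _ _ _ _ rhoNE).
  rewrite (entropyE _ _ _ _ sigmaE) (entropyE _ _ _ _ sigmaNE).
  rewrite /V (defect_logE rhoE sigmaME rhoNE sigmaNNE) // !mulrBr !(traceB tau_tracial).
  rewrite -(sigma_rho _ (calculus_in Psub sigmaE _)).
  rewrite -(rhoN_rho _ (calculus_in Nsub rhoNE _)).
  rewrite -(sigma_rho _ (QP _ (calculus_in Qsub sigmaNE _))).
  rewrite -(sigmaP _ (QP _ (calculus_in Qsub sigmaNE _))) sigmaNP;
    last exact: (calculus_in Qsub sigmaNE).
  set w := tau _; set x := tau _; set y := tau _; set z := tau _.
  by have -> : - w - - x - - y - z = y - w - (z - x) by ring.
have V_ge0 := trace_defect_ge0 tau_tracial Nsub rhoE sigmaME rhoNE sigmaNNE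
  p0 q0 p'0 q'0 rhoN_rho sigmaN_sigma.
have V_eq0 := defect_eq0 tau_tracial Msub Nsub NM Mf rhoE sigmaME rhoNE sigmaNNE
  p0 q0 p'0 q'0 rhoN_rho sigmaN_sigma.
split.
- move=> [E [Ecp E1 E_mod E_phi E_BC]].
  have EN y : M y -> N (E y) by case: Ecp => _ + _; exact.
  have E_rho y : M y -> tau (rho * E y) = tau (rho * y).
    move=> My; have MEy := NM _ (EN _ My).
    by rewrite -(rhoP _ MEy) -(rhoP _ My) E_phi.
  have E_P y : P y -> P (E y) by move=> /E_BC/QP.
  have M_ind (Pr : T -> Prop) : (forall x y, LA x -> P y -> Pr (x * y)) ->
      (forall x y, Pr x -> Pr y -> Pr (x + y)) -> forall z, M z -> Pr z.
    rewrite LAE PE ME'; exact: clifford_cat_ind.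
  have tau_prod x y : LA x -> P y -> tau (x * y) = tau x * tau y.
    by rewrite LAE PE; exact: (trace_prod c_sqr c_anti fresh tau_tracial uM').
  split; last first.
    move=> x Ax; split; first exact: AN.
    by move=> t; apply: (modular_flow_in tau_tracial Msub Nsub Psub NM PM AN Mf
      M_ind tau_prod
      sigmaE q0 sigma_rho Ecp E1 E_mod E_rho E_P).
  apply/ssaE; rewrite /V V_eq0 ?mulr0 ?(trace0 tau_tracial) // => s s0.
  apply/le_anti/andP; split; last exact: V_ge0.
  apply: (trace_defect_le0 tau_tracial Msub Nsub rhoE sigmaME rhoNE sigmaNNE
    p0 q0 p'0 q'0 rhoN_rho sigmaN_sigma s0 (E := E)) => y My.
  exact: (cp_contracts tau_tracial Msub Nsub Psub NM PM AN M_ind tau_prod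
    rhoE sigmaE p0 q0 sigma_rho Ecp E1 E_mod E_rho E_P).
- move=> [/ssaE V_ln flow_in].
  have V0 := V_eq0 (defect_log_eq0 tau_tracial Msub Nsub NM rhoE sigmaME rhoNE sigmaNNE
    p0 q0 p'0 q'0 rhoN_rho sigmaN_sigma V_ln).
  have cocycle := defect_root rhoE sigmaME rhoNE sigmaNNE p0 q0 p'0 q'0 (V0 root_of).
  have flow x t : LA x -> N (ipow sigma t * x * ipow sigma (- t)).
    by move=> /flow_in[_]; exact.
  exists (recovery CE q f q' f'); split.
  + apply: (cp_conjugated_condexp tau_tracial Msub Nsub Nf _ CE_lin CE_in CE_star
      CE_Ml CE_Mr CE_tau).
    * by rewrite NE; exact: span.
    * by apply: PM; exact: (calculus_in Psub sigmaE).
    * exact: (calculus_root_star sigmaE).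
    * by apply: QN; exact: (calculus_in Qsub sigmaNE).
    * exact: (calculus_Vroot_star sigmaNE).
  + exact: (recovery1 sigmaE sigmaNE q0 q'0 CE_sigma).
  + move=> x y; exact: (recovery_mod Nsub Qsub QN AN CE_Ml CE_Mr sigmaE sigmaNE).
  + move=> x Mx.
    have NFx := recovery_in Msub Nsub Psub Qsub PM QN CE_in sigmaE sigmaNE Mx.
    rewrite (rhoP _ (NM _ NFx)) (rhoP _ Mx).
    exact: (recovery_rho tau_tracial Msub Nsub Psub Qsub PM QN CE_in CE_Ml CE_tau
      rhoE sigmaE rhoNE sigmaNE).
  + move=> x; exact: (recovery_P Psub Qsub CE_P sigmaE sigmaNE).
Qed.
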